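(* Let $m,p,n\geq1$, let $\mathfrak{F}_0\subseteq\mathfrak{F}_1\subseteq\cdots\subseteq\mathfrak{F}_n$ be a filtration on a probability space, and let $\mathcal{X}_1,\dots,\mathcal{X}_n\in\mathbb{C}^{m\times m\times p}$ be random Hermitian T-product tensors adapted to it ($\mathcal{X}_i$ is $\mathfrak{F}_i$-measurable). Let $\mathcal{A}_1,\dots,\mathcal{A}_n\in\mathbb{C}^{m\times m\times p}$ be fixed Hermitian T-product tensors such that for each $i$, $$\mathbb{E}_{i-1}\mathcal{X}_i=\mathcal{O}\quad\text{and}\quad\mathcal{X}_i^2\preceq\mathcal{A}_i^2\ \text{almost surely},$$ where $\mathbb{E}_{i-1}$ denotes conditional expectation given $\mathfrak{F}_{i-1}$. Let $\sigma^2=\left\Vert\sum_{i=1}^n\mathcal{A}_i^2\right\Vert$. Then for all $\theta\ge0$, $$\Pr\left(\lambda_{\max}\left(\sum_{i=1}^n\mathcal{X}_i\right)\geq\theta\right)\leq mp\,e^{-\theta^2/(8\sigma^2)}.$$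
   Context: For $\mathcal{A}\in\mathbb{C}^{m\times n\times p}$ with frontal slices $A^{(1)},\dots,A^{(p)}$, $\mathrm{bcirc}(\mathcal{A})\in\mathbb{C}^{mp\times np}$ is the block circulant matrix whose $(r,s)$ block is $A^{(((r-s)\bmod p)+1)}$. The T-product $\mathcal{A}\star\mathcal{B}$ is the tensor with $\mathrm{bcirc}(\mathcal{A}\star\mathcal{B})=\mathrm{bcirc}(\mathcal{A})\mathrm{bcirc}(\mathcal{B})$, and $\mathcal{A}^2=\mathcal{A}\star\mathcal{A}$. The conjugate transpose $\mathcal{A}^{\mathrm H}$ is obtained by conjugate-transposing every frontal slice and reversing the order of slices $2,\dots,p$. $\mathcal{A}\in\mathbb{C}^{m\times m\times p}$ is Hermitian if $\mathcal{A}^{\mathrm H}=\mathcal{A}$; its eigenvalues are the $mp$ eigenvalues of $\mathrm{bcirc}(\mathcal{A})$, with largest $\lambda_{\max}$. For Hermitian $\mathcal{A},\mathcal{B}$, $\mathcal{A}\preceq\mathcal{B}$ means $\mathrm{bcirc}(\mathcal{B}-\mathcal{A})$ is positive semidefinite. $\Vert\mathcal{A}\Vert$ is the largest singular value of $\mathrm{bcirc}(\mathcal{A})$. $\mathcal{O}$ is the zero tensor; (conditional) expectation is entrywise. *)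

(* Defs.v *)
From HB Require Import structures.
From mathcomp Require Import all_boot all_order all_algebra.
From mathcomp Require Import sesquilinear spectral.
From mathcomp Require Import complex.
From mathcomp Require Import all_classical all_reals all_analysis.

Set Implicit Arguments.
Unset Strict Implicit.
Unset Printing Implicit Defensive.

Import Order.TTheory GRing.Theory Num.Theory.
Local Open Scope ring_scope.
Local Open Scope classical_set_scope.

(* T-product tensors in C^{m x m x p}: p frontal slices, each an m x m matrix.
   Slice index k : 'I_p is the 0-based version of the paper's slice k+1. *)
Definition tensor (R : rcfType) (m p : nat) := {ffun 'I_p -> 'M[R[i]]_m}.

Lemma ord_pos (p : nat) (k : 'I_p) : (0 < p)%N.
Proof. by apply: leq_ltn_trans (ltn_ord k). Qed.

Definition submod (p : nat) (r s : 'I_p) : 'I_p :=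
  Ordinal (ltn_pmod (r + p - s) (ord_pos r)).

Definition negmod (p : nat) (k : 'I_p) : 'I_p :=
  Ordinal (ltn_pmod (p - k) (ord_pos k)).

Definition bcirc (R : rcfType) (m p : nat) (A : tensor R m p)
  : 'M[R[i]]_(\sum_(r < p) m) :=
  \mxblock_(r < p, s < p) A (submod r s).

(* T-product: the tensor whose bcirc is bcirc A *m bcirc B; its k-th slice is
   the (k,0) block of bcirc A *m bcirc B, namely sum_j A_{(k-j) mod p} B_j *)
Definition tprod (R : rcfType) (m p : nat) (A B : tensor R m p) : tensor R m p :=
  [ffun k => \sum_(j < p) A (submod k j) *m B j].

Definition tsq (R : rcfType) (m p : nat) (A : tensor R m p) := tprod A A.

Definition tconjT (R : rcfType) (m p : nat) (A : tensor R m p) : tensor R m p :=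
  [ffun k => map_mx Num.conj ((A (negmod k))^T)].

Definition thermitian (R : rcfType) (m p : nat) (A : tensor R m p) : Prop :=
  tconjT A = A.

Definition psdmx (R : rcfType) (N : nat) (M : 'M[R[i]]_N) : Prop :=
  forall v : 'rV[R[i]]_N, 0 <= (v *m M *m (map_mx Num.conj (v^T))) 0 0.

Definition tle (R : rcfType) (m p : nat) (A B : tensor R m p) : Prop :=
  psdmx (bcirc (B - A)).

Definition lambda_max (R : realType) (N : nat) (M : 'M[R[i]]_N) : R :=
  sup [set complex.Re a | a in [set a | eigenvalue M a]].

Definition opnorm (R : realType) (N : nat) (M : 'M[R[i]]_N) : R :=
  Num.sqrt (lambda_max (map_mx Num.conj (M^T) *m M)).

Definition tlambda_max (R : realType) (m p : nat) (A : tensor R m p) : R :=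
  lambda_max (bcirc A).
Definition tnorm (R : realType) (m p : nat) (A : tensor R m p) : R :=
  opnorm (bcirc A).

Definition measurable_wrt (T : Type) (R : realType) (G : set (set T)) (f : T -> R)
  : Prop := forall B : set R, measurable B -> G (f @^-1` B).

Definition tmeasurable_wrt (T : Type) (R : realType) (m p : nat)
  (G : set (set T)) (X : T -> tensor R m p) : Prop :=
  forall (k : 'I_p) (a b : 'I_m),
    measurable_wrt G (fun w => complex.Re (X w k a b)) /\
    measurable_wrt G (fun w => complex.Im (X w k a b)).

(* E[f | G] = 0 for a real random variable f: f integrable and
   int_B f dP = 0 for every B in G (defining property of conditional
   expectation, with the version 0). *)
Definition cond_exp_zero (d : measure_display) (T : measurableType d)
  (R : realType) (P : probability T R) (G : set (set T)) (f : T -> R) : Prop :=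
  P.-integrable setT (fun w => (f w)%:E) /\
  forall B, G B -> (\int[P]_(w in B) (f w)%:E = 0)%E.

Definition tcond_exp_zero (d : measure_display) (T : measurableType d)
  (R : realType) (P : probability T R) (m p : nat) (G : set (set T))
  (X : T -> tensor R m p) : Prop :=
  forall (k : 'I_p) (a b : 'I_m),
    cond_exp_zero P G (fun w => complex.Re (X w k a b)) /\
    cond_exp_zero P G (fun w => complex.Im (X w k a b)).

Definition filtration (d : measure_display) (T : measurableType d) (n : nat)
  (F : nat -> set (set T)) : Prop :=
  (forall i, (i <= n)%N -> sigma_algebra setT (F i) /\ F i `<=` measurable) /\
  (forall i j, (i <= j <= n)%N -> F i `<=` F j).

(* Main.v *)
(* The trace exponential satisfies, pointwise and without Lieb's theorem,
     tr e^(H+X) <= tr e^(H+2B) + tr (X e^H)   whenever X^2 <= B.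
   Applied conditionally on F_i this makes
     tr exp (sum_(j < k) s X_j + 2 s^2 sum_(j >= k) A_j^2)
   a supermartingale in k, because the term linear in X has mean zero; the
   Laplace transform method with s = theta / (4 sigma^2) concludes.

   The pointwise bound reduces by convexity of tr exp to
     tr e^(H+Y) + tr e^(H-Y) <= 2 tr e^(H+Y^2/2),   Y = 2X.
   This holds because tr e^(H+tY+(1-t^2)Y^2/2) + tr e^(H-tY+(1-t^2)Y^2/2) is
   nonincreasing in t, which follows from
     tr (A-B)(e^A-e^B) <= tr (A-B)^2 (e^A+e^B) / 2.
   As tr f(A) g(B) = sum_(i,j) f(a_i) g(b_j) |<u_i, v_j>|^2 over eigenbases of
   A and B, the latter is the scalar inequality |tanh x| <= |x|. *)
Require Import Defs.
From HB Require Import structures.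
From mathcomp Require Import all_boot all_order all_algebra.
From mathcomp Require Import sesquilinear spectral complex.
From mathcomp Require Import all_classical all_reals all_analysis.
From mathcomp Require Import measurable_realfun zify ring lra.
Import Order.TTheory GRing.Theory Num.Theory.
Import numFieldNormedType.Exports.
Local Open Scope ring_scope.
Local Open Scope classical_set_scope.
Local Open Scope sesquilinear_scope.

Set Implicit Arguments.
Unset Strict Implicit.
Unset Printing Implicit Defensive.

(** The increments do not commute with the past, so e^(H+X) does not factor. The pointwise bound is
    therefore arranged so that its only term linear in X is tr (X e^H), where H depends on the past
    alone. With the quadratic correction 2 s^2 A_j^2 the Laplace exponent is 2 s^2 sigma^2 - s
    theta, and its minimum -theta^2 / (8 sigma^2) is the origin of the 8.

    Trace exponentials are never differentiated. Monotonicity in t is replaced by a comparison over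
    short steps whose error is quadratic in the step length, so that the accumulated error vanishes
    as the mesh is refined.

    On the probabilistic side, a zero conditional mean is given only through integrals over events.
    That tr (X e^H) has mean zero thus requires a pull-out property for bounded factors, and the
    boundedness of e^H comes from X_i^2 <= A_i^2. *)

(* An abstract stand-in for R[i] with its real and imaginary parts: over R[i]
   itself, unification keeps unfolding the field operations. *)
Record cplx (R : realType) (C : numClosedFieldType) := Cplx {
  ReC : C -> R;
  ImC : C -> R;
  r2c : R -> C;
  ReCD : forall x y, ReC (x + y) = ReC x + ReC y;
  ImCD : forall x y, ImC (x + y) = ImC x + ImC y;
  ReCM : forall x y, ReC (x * y) = ReC x * ReC y - ImC x * ImC y;
  ImCM : forall x y, ImC (x * y) = ReC x * ImC y + ImC x * ReC y;
  ReC_conj : forall x, ReC (Num.conj x) = ReC x;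
  ImC_conj : forall x, ImC (Num.conj x) = - ImC x;
  ReC_r2c : forall a, ReC (r2c a) = a;
  ImC_r2c : forall a, ImC (r2c a) = 0;
  ReIm_inj : forall x y, ReC x = ReC y -> ImC x = ImC y -> x = y;
  ge0_ReIm : forall x, 0 <= x -> 0 <= ReC x /\ ImC x = 0
}.

(** * Arithmetic of real and imaginary parts *)

Section ReIm.
Variables (R : realType) (C : numClosedFieldType) (S : cplx R C).
Local Notation ReC := (ReC S).
Local Notation ImC := (ImC S).
Local Notation "x %:C" := (r2c S x) (at level 1, format "x %:C").

Lemma ReC0 : ReC 0 = 0.
Proof. by apply: (addrI (ReC 0)); rewrite -ReCD !addr0. Qed.
Lemma ImC0 : ImC 0 = 0.
Proof. by apply: (addrI (ImC 0)); rewrite -ImCD !addr0. Qed.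
Lemma ReCN (x : C) : ReC (- x) = - ReC x.
Proof. by apply: (addrI (ReC x)); rewrite -ReCD !subrr ReC0. Qed.
Lemma ImCN (x : C) : ImC (- x) = - ImC x.
Proof. by apply: (addrI (ImC x)); rewrite -ImCD !subrr ImC0. Qed.
Lemma ReCZ (a : R) (x : C) : ReC (a%:C * x) = a * ReC x.
Proof. by rewrite ReCM ReC_r2c ImC_r2c mul0r subr0. Qed.
Lemma ImCZ (a : R) (x : C) : ImC (a%:C * x) = a * ImC x.
Proof. by rewrite ImCM ReC_r2c ImC_r2c mul0r addr0. Qed.
Lemma ReC_sum I (r : seq I) (P : pred I) (F : I -> C) :
  ReC (\sum_(i <- r | P i) F i) = \sum_(i <- r | P i) ReC (F i).
Proof. by apply: (big_morph ReC) => [x y|]; [exact: ReCD|exact: ReC0]. Qed.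
Lemma ImC_sum I (r : seq I) (P : pred I) (F : I -> C) :
  ImC (\sum_(i <- r | P i) F i) = \sum_(i <- r | P i) ImC (F i).
Proof. by apply: (big_morph ImC) => [x y|]; [exact: ImCD|exact: ImC0]. Qed.
Lemma conj_r2c (a : R) : Num.conj a%:C = a%:C.
Proof. by apply: (ReIm_inj (c:=S)); rewrite ?ReC_conj// ImC_conj ImC_r2c oppr0. Qed.
Lemma r2cD (a b : R) : (a + b)%:C = a%:C + b%:C.
Proof. by apply: (ReIm_inj (c:=S)); rewrite ?ReCD ?ImCD ?ReC_r2c ?ImC_r2c ?addr0. Qed.
Lemma r2cN (a : R) : (- a)%:C = - a%:C.
Proof. by apply: (ReIm_inj (c:=S)); rewrite ?ReCN ?ImCN ?ReC_r2c ?ImC_r2c ?oppr0. Qed.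
Lemma r2cB (a b : R) : (a - b)%:C = a%:C - b%:C.
Proof. by rewrite r2cD r2cN. Qed.
Lemma r2cM (a b : R) : (a * b)%:C = a%:C * b%:C.
Proof.
by apply: (ReIm_inj (c:=S)); 
  rewrite ?ReCM ?ImCM ?ReC_r2c ?ImC_r2c ?mulr0 ?mul0r ?subr0 ?addr0.
Qed.
Lemma r2c_inj : injective (r2c S).
Proof. by move=> a b /(congr1 ReC); rewrite !ReC_r2c. Qed.
Lemma r2c0 : (0 : R)%:C = 0.
Proof. by apply: (ReIm_inj (c:=S)); rewrite ?ReC_r2c ?ImC_r2c ?ReC0 ?ImC0. Qed.
Lemma r2c1 : (1 : R)%:C = 1.
Proof.
have n0 : (1 : R)%:C != 0.
  by apply/eqP => /(congr1 ReC); rewrite ReC_r2c ReC0 => /eqP; rewrite oner_eq0.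
by apply: (mulfI n0); rewrite -r2cM !mulr1.
Qed.
Lemma real_r2c (z : C) : z \is Num.real -> z = (ReC z)%:C.
Proof.
rewrite realE => z0; apply: (ReIm_inj (c:=S)); rewrite ?ReC_r2c// ImC_r2c.
have [/(ge0_ReIm S)[]//|nz0] := boolP (0 <= z).
move: z0; rewrite (negbTE nz0) /= -oppr_ge0 => /(ge0_ReIm S)[_].
by rewrite ImCN => /eqP; rewrite oppr_eq0 => /eqP.
Qed.

End ReIm.

(** * Functional calculus of Hermitian matrices and double sums over two spectra *)

Lemma mxtrace_conj2 (K : comNzRingType) N (U U' V V' D E : 'M[K]_N) :
  \tr (U' *m D *m U *m (V' *m E *m V)) = \tr (D *m (U *m V') *m (E *m (V *m U'))).
Proof. by rewrite -!mulmxA mxtrace_mulC !mulmxA. Qed.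

Section FunctionalCalculus.
Variables (R : realType) (C : numClosedFieldType) (S : cplx R C) (N : nat).
Local Notation ReC := (ReC S).
Local Notation ImC := (ImC S).
Local Notation "x %:C" := (r2c S x) (at level 1, format "x %:C").
Implicit Types (A B H K X Y M : 'M[C]_N) (f g : R -> R).

Definition retr M : R := ReC (\tr M).

Lemma retrD A B : retr (A + B) = retr A + retr B.
Proof. by rewrite /retr mxtraceD ReCD. Qed.
Lemma retrN A : retr (- A) = - retr A.
Proof. by rewrite /retr raddfN ReCN. Qed.
Lemma retrZ (a : R) A : retr (a%:C *: A) = a * retr A.
Proof. by rewrite /retr mxtraceZ ReCZ. Qed.
Lemma retrC A B : retr (A *m B) = retr (B *m A).
Proof. by rewrite /retr mxtrace_mulC. Qed.

Definition hermmx M : Prop := M ^t* = M.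

Lemma hermmx_sym A : hermmx A -> A \is hermsymmx.
Proof. by move=> hA; apply/is_hermitianmxP; rewrite expr0 scale1r hA. Qed.

Lemma ctrD A B : (A + B) ^t* = A ^t* + B ^t*.
Proof. by rewrite linearD /= map_mxD. Qed.
Lemma ctrM A B : (A *m B) ^t* = B ^t* *m A ^t*.
Proof. by rewrite trmx_mul map_mxM. Qed.
Lemma ctrZ (a : R) A : (a%:C *: A) ^t* = a%:C *: A ^t*.
Proof. by rewrite linearZ /= map_mxZ; congr (_ *: _); exact: conj_r2c. Qed.

Lemma hermmxD A B : hermmx A -> hermmx B -> hermmx (A + B).
Proof. by move=> hA hB; rewrite /hermmx ctrD hA hB. Qed.
Lemma hermmxZ (a : R) A : hermmx A -> hermmx (a%:C *: A).
Proof. by move=> hA; rewrite /hermmx ctrZ hA. Qed.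
Lemma hermmxN A : hermmx A -> hermmx (- A).
Proof. by move=> hA; rewrite /hermmx linearN /= map_mxN hA. Qed.
Lemma hermmx0 : hermmx 0.
Proof. by rewrite /hermmx trmx0 map_mx0. Qed.
Lemma hermmx_sum I (r : seq I) (Q : pred I) (F : I -> 'M[C]_N) :
  (forall i, Q i -> hermmx (F i)) -> hermmx (\sum_(i <- r | Q i) F i).
Proof. by move=> hF; elim/big_ind: _ => //; [exact: hermmx0|exact: hermmxD]. Qed.
Lemma hermmx_sqr A : hermmx A -> hermmx (A *m A).
Proof. by move=> hA; rewrite /hermmx ctrM hA. Qed.

Definition psd M : Prop := forall v : 'rV[C]_N, 0 <= ReC ((v *m M *m v ^t*) 0 0).

Definition eigs A (i : 'I_N) : R := ReC (spectral_diag A 0 i).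

Fact fmx_key : unit. Proof. exact: tt. Qed.
(** Locked so that unification does not unfold the spectral decomposition; [fmxE] opens it on
    demand. *)
Definition fmx f A : 'M[C]_N := locked_with fmx_key
  ((spectralmx A) ^t* *m diag_mx (\row_i (f (eigs A i))%:C) *m spectralmx A).

Lemma fmxE f A : fmx f A =
  (spectralmx A) ^t* *m diag_mx (\row_i (f (eigs A i))%:C) *m spectralmx A.
Proof. exact: locked_withE. Qed.

Lemma spectralmxK A : spectralmx A *m (spectralmx A) ^t* = 1%:M.
Proof. exact/unitarymxP/spectral_unitarymx. Qed.

Lemma spectralmxVK A : (spectralmx A) ^t* *m spectralmx A = 1%:M.
Proof. exact/mulmx1C/spectralmxK. Qed.

Lemma fmx_id A : hermmx A -> fmx id A = A.
Proof.
move=> hA; have hs := hermmx_sym hA.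
rewrite [RHS](orthomx_spectralP (hermitian_normalmx hs)).
rewrite invmx_unitary ?spectral_unitarymx// fmxE.
suff -> : \row_i (id (eigs A i))%:C = spectral_diag A by [].
apply/rowP => i; rewrite mxE.
have /mxOverP/(_ 0 i) := hermitian_spectral_diag_real hs.
by move=> /(real_r2c S) <-.
Qed.

Lemma fmxM f g A : fmx f A *m fmx g A = fmx (fun x => f x * g x) A.
Proof.
rewrite !fmxE; have := spectralmxK A.
have <- : diag_mx (\row_i (f (eigs A i))%:C) *m diag_mx (\row_i (g (eigs A i))%:C) =
    diag_mx (\row_i (f (eigs A i) * g (eigs A i))%:C).
  by rewrite mulmx_diag; congr diag_mx; apply/rowP => i; rewrite !mxE r2cM.
move: (spectralmx A) (diag_mx _) (diag_mx _) => U D E UK.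
by rewrite -!mulmxA (mulmxA U) UK mul1mx.
Qed.

Lemma fmx1 A : fmx (fun=> 1) A = 1%:M.
Proof.
rewrite !fmxE (_ : \row_i _ = const_mx 1) ?diag_const_mx ?mulmx1 ?spectralmxVK//.
by apply/rowP => i; rewrite !mxE r2c1.
Qed.

Lemma fmx_ext f g A : (forall i, f (eigs A i) = g (eigs A i)) -> fmx f A = fmx g A.
Proof.
move=> fg; rewrite !fmxE (_ : \row_i _ = \row_i (g (eigs A i))%:C)//.
by apply/rowP => i; rewrite !mxE fg.
Qed.

(** This is |<u_i, v_j>|^2 for the eigenbases of A and B, written through real and imaginary parts
    so that it lives in [R]. *)
Definition overlap A B i j : R :=
  let z := (spectralmx A *m (spectralmx B) ^t*) i j in
  ReC z ^+ 2 + ImC z ^+ 2.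

Lemma overlap_ge0 A B i j : 0 <= overlap A B i j.
Proof. by rewrite addr_ge0 ?sqr_ge0. Qed.

(** For F a sum of products f(a) g(b) this is the corresponding sum of traces tr f(A) g(B). Since
    the weights are nonnegative, a scalar inequality on pairs of eigenvalues becomes a trace
    inequality, even when A and B do not commute. *)
Definition dsum A B (F : R -> R -> R) : R :=
  \sum_i \sum_j F (eigs A i) (eigs B j) * overlap A B i j.

Lemma dsum_le A B (F G : R -> R -> R) :
  (forall i j, F (eigs A i) (eigs B j) <= G (eigs A i) (eigs B j)) ->
  dsum A B F <= dsum A B G.
Proof.
move=> FG; apply: ler_sum => i _; apply: ler_sum => j _.
by rewrite ler_wpM2r ?overlap_ge0.
Qed.

Lemma dsumD A B F G : dsum A B (fun a b => F a b + G a b) = dsum A B F + dsum A B G.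
Proof.
rewrite /dsum -big_split /=; apply: eq_bigr => i _.
by rewrite -big_split /=; apply: eq_bigr => j _; rewrite mulrDl.
Qed.

Lemma dsumZ A B c F : dsum A B (fun a b => c * F a b) = c * dsum A B F.
Proof.
rewrite /dsum mulr_sumr; apply: eq_bigr => i _.
by rewrite mulr_sumr; apply: eq_bigr => j _; rewrite mulrA.
Qed.

Lemma dsumB A B F G : dsum A B (fun a b => F a b - G a b) = dsum A B F - dsum A B G.
Proof.
rewrite -mulN1r -dsumZ -dsumD; congr dsum.
by apply/funext => a; apply/funext => b; rewrite mulN1r.
Qed.

Lemma retr_diag_unitary (U V : 'M[C]_N) (d e : 'rV[C]_N) :
  retr (U ^t* *m diag_mx d *m U *m (V ^t* *m diag_mx e *m V)) =
  retr (diag_mx d *m (U *m V ^t*) *m (diag_mx e *m (U *m V ^t*) ^t*)).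
Proof.
by rewrite ctrM trmxCK /retr mxtrace_conj2.
Qed.

Lemma dsumE A B f g : dsum A B (fun a b => f a * g b) = retr (fmx f A *m fmx g B).
Proof.
rewrite !fmxE retr_diag_unitary /dsum /overlap.
move: (spectralmx A *m _) => W.
rewrite /retr /mxtrace ReC_sum; apply: eq_bigr => i _.
rewrite mxE ReC_sum; apply: eq_bigr => j _.
rewrite 2!mul_diag_mx !mxE.
by rewrite !(ReCM, ImCM, ReC_conj, ImC_conj, ReC_r2c, ImC_r2c); ring.
Qed.

Lemma dsumEl A B f : dsum A B (fun a b => f a) = retr (fmx f A).
Proof.
by rewrite -(mulmx1 (fmx f A)) -(fmx1 B) -dsumE;
  congr dsum; apply/funext => a; apply/funext => b; rewrite mulr1.
Qed.

Lemma dsumEr A B f : dsum A B (fun a b => f b) = retr (fmx f B).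
Proof.
by rewrite -(mul1mx (fmx f B)) -(fmx1 A) -dsumE;
  congr dsum; apply/funext => a; apply/funext => b; rewrite mul1r.
Qed.

Lemma retr_fmx f A : retr (fmx f A) = \sum_i f (eigs A i).
Proof.
rewrite fmxE retrC mulmxA spectralmxK mul1mx /retr mxtrace_diag ReC_sum.
by apply: eq_bigr => i _; rewrite mxE ReC_r2c.
Qed.

Definition trexp A : R := retr (fmx expR A).

Lemma trexpE A : trexp A = \sum_i expR (eigs A i).
Proof. exact: retr_fmx. Qed.

Lemma trexp_ge0 A : 0 <= trexp A.
Proof. by rewrite trexpE sumr_ge0// => i _; exact: expR_ge0. Qed.

End FunctionalCalculus.

(** * Scalar inequalities for the exponential *)

Section ScalarExp.
Variable R : realType.
Implicit Types (a b x : R).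

Lemma expR_tangent a b : expR a + (b - a) * expR a <= expR b.
Proof.
have -> : expR b = expR a * expR (b - a) by rewrite -expRD addrC subrK.
have := expR_ge1Dx (b - a); have := expR_gt0 a; nra.
Qed.

(** A cross-multiplied form of tanh (x/2) <= x/2. The difference [h] vanishes at 0, and its
    derivative 1 - (1 - y) e^y is nonnegative because e^(-y) >= 1 - y. *)
Lemma expR_pade x : 0 <= x -> expR x * (2 - x) <= 2 + x.
Proof.
move=> x0; pose h y : R := (2 + y) - expR y * (2 - y).
have dh (y : R) : is_derive y 1 h (1 + expR y * (y - 1)).
  rewrite /h; apply: is_derive_eq.
  rewrite /GRing.scale /=; ring.
have : h 0 <= h x.
  apply: (@ger0_derive1_le R h 0 x _ _ true false) => //.
  - move=> y; rewrite in_itv /= => /andP[y0 _].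
    rewrite derive1E (@derive_val _ _ _ _ _ _ _ (dh y)).
    have := expR_ge1Dx (- y); rewrite expRN => e1.
    have := expR_gt0 y => e0.
    have : (1 - y) * expR y <= 1.
      by rewrite -ler_pdivlMr// mul1r.
    lra.
  - by apply: derivable_within_continuous => y _; apply: ex_derive.
  - by rewrite in_itv /= lexx.
  - by rewrite in_itv /= x0 lexx.
by rewrite /h expR0; lra.
Qed.

(* This is |tanh u| <= |u| at u = (a - b) / 2. *)
Lemma expR_diff_quadratic a b :
  (a - b) * (expR a - expR b) <= 2^-1 * ((a - b) ^+ 2 * (expR a + expR b)).
Proof.
wlog ab : a b / b <= a.
  move=> H; have [/H//|/ltW/H] := leP b a.
  by congr (_ <= _); ring.
have -> : expR a = expR b * expR (a - b) by rewrite -expRD addrC subrK.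
have ab0 : 0 <= a - b by lra.
have := expR_pade ab0; have := expR_gt0 b; move: (a - b) ab0 (expR (a - b)).
move=> x x0 e b0 h.
have : 0 <= x * expR b * ((2 + x) - e * (2 - x)).
  by rewrite mulr_ge0 ?subr_ge0// mulr_ge0// ltW.
lra.
Qed.

End ScalarExp.

(** * Trace identities *)

Section TraceIdentities.
Variables (K : comNzRingType) (N : nat).
Implicit Types A B P Q U V : 'M[K]_N.

Lemma mxtrace_diff_mul A B P Q :
  \tr ((A - B) *m (P - Q)) =
  \tr (A *m P) - \tr (P *m B) - \tr (A *m Q) + \tr (B *m Q).
Proof.
rewrite mulmxBl !mulmxBr !(mxtraceD, raddfN) /= !mxtraceD !raddfN /= (mxtrace_mulC B P).
by ring.
Qed.

(** Meant for P = e^A and Q = e^B: commutation and cyclicity bring every product into the shape tr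
    f(A) g(B) of [dsumE]. *)
Lemma mxtrace_sqr_diff_mul A B P Q : P *m A = A *m P -> Q *m B = B *m Q ->
  \tr ((A - B) *m (A - B) *m (P + Q)) =
  (\tr (A *m (A *m P)) - (\tr (A *m P *m B) + \tr (A *m P *m B)) + \tr (P *m (B *m B)))
  + (\tr (A *m A *m Q) - (\tr (A *m (B *m Q)) + \tr (A *m (B *m Q)))
     + \tr (B *m (B *m Q))).
Proof.
move=> cA cB; rewrite mulmxDr mxtraceD.
have sqE : (A - B) *m (A - B) = A *m A - (A *m B + B *m A) + B *m B.
  by rewrite mulmxBl !mulmxBr opprB opprD !addrA addrAC.
congr (_ + _); rewrite sqE mulmxDl mulmxBl mulmxDl !mxtraceD raddfN /= mxtraceD.
- have -> : \tr (A *m B *m P) = \tr (A *m P *m B).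
    by rewrite mxtrace_mulC mulmxA cA.
  have -> : \tr (B *m A *m P) = \tr (A *m P *m B).
    by rewrite -mulmxA mxtrace_mulC.
  by rewrite mulmxA (mxtrace_mulC (B *m B)).
- have -> : \tr (B *m A *m Q) = \tr (A *m (B *m Q)).
    by rewrite -mulmxA mxtrace_mulC -mulmxA cB.
  by rewrite !mulmxA.
Qed.

Lemma mxtrace_conj U V Q D :
  \tr (Q *m (V *m D *m U)) = \tr (D *m (U *m Q *m V)).
Proof. by rewrite mxtrace_mulC -!mulmxA mxtrace_mulC -!mulmxA. Qed.

End TraceIdentities.

(** * Inequalities for the trace exponential *)

Section TraceInequalities.
Variables (R : realType) (C : numClosedFieldType) (S : cplx R C) (N : nat).
Local Notation ReC := (ReC S).
Local Notation "x %:C" := (r2c S x) (at level 1, format "x %:C").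
Local Notation retr := (retr S).
Local Notation fmx := (fmx S).
Local Notation eigs := (eigs S).
Local Notation dsum := (dsum S).
Local Notation trexp := (trexp S).
Local Notation psd := (psd S).
Implicit Types (A B H K X Y M : 'M[C]_N) (f g : R -> R).
Local Notation E := (fmx expR).

Lemma retr_fmxl f A : hermmx A -> retr (A *m fmx f A) = retr (fmx (fun x => x * f x) A).
Proof. by move=> hA; rewrite -{1}(fmx_id S hA) fmxM. Qed.

(** Klein's inequality: the tangent line bound for exp, summed over pairs of eigenvalues. It serves
    as the substitute for differentiating the trace exponential. *)
Lemma trexp_klein A B : hermmx A -> hermmx B ->
  trexp A - trexp B <= retr ((A - B) *m E A).
Proof.
move=> hA hB; rewrite /trexp.
have -> : retr ((A - B) *m E A) =
    dsum A B (fun a b => a * expR a) - dsum A B (fun a b => expR a * b).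
  by rewrite dsumEl dsumE fmx_id// mulmxBl retrD retrN retr_fmxl// (retrC S B).
rewrite -(dsumEl S A B expR) -(dsumEr S A B expR) -!dsumB.
by apply: dsum_le => i j /=; have := expR_tangent (eigs A i) (eigs B j); lra.
Qed.

Lemma trexp_diff_quadratic A B : hermmx A -> hermmx B ->
  retr ((A - B) *m (E A - E B)) <=
  2^-1 * retr ((A - B) *m (A - B) *m (E A + E B)).
Proof.
move=> hA hB.
have -> : retr ((A - B) *m (E A - E B)) =
    dsum A B (fun a b => (a - b) * (expR a - expR b)).
  (* The summand is expanded into multiples of products f(a) g(b), the only shape that [dsumE] turns
     into traces. *)
  have -> : (fun a b : R => (a - b) * (expR a - expR b)) =
    (fun a b => a * expR a + ((-1) * (expR a * b) + ((-1) * (a * expR b) + b * expR b))).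
    by apply/funext => a; apply/funext => b; ring.
  rewrite !dsumD !dsumZ (dsumEl S A B (fun a => a * expR a)).
  rewrite (dsumEr S A B (fun a => a * expR a)).
  rewrite (dsumE S A B expR id) (dsumE S A B id expR).
  rewrite !fmx_id// -!retr_fmxl// /retr mxtrace_diff_mul !ReCD !ReCN.
  by move: (ReC _) (ReC _) (ReC _) (ReC _) => a b c d; ring.
have cE K : hermmx K -> E K *m K = K *m E K.
  move=> hK; have := fmxM S expR id K; have := fmxM S id expR K.
  rewrite fmx_id// => -> ->.
  by apply: fmx_ext => i; rewrite mulrC.
have -> : retr ((A - B) *m (A - B) *m (E A + E B)) =
    dsum A B (fun a b => (a - b) ^+ 2 * (expR a + expR b)).
  have -> : (fun a b : R => (a - b) ^+ 2 * (expR a + expR b)) =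
    (fun a b => (a * (a * expR a) + ((-2) * ((a * expR a) * b) + expR a * (b * b)))
    + ((a * a) * expR b + ((-2) * (a * (b * expR b)) + b * (b * expR b)))).
    by apply/funext => a; apply/funext => b; ring.
  rewrite !dsumD !dsumZ (dsumEl S A B (fun a => a * (a * expR a))).
  rewrite (dsumEr S A B (fun b => b * (b * expR b))).
  rewrite (dsumE S A B (fun a => a * expR a) id) (dsumE S A B expR (fun b => b * b)).
  rewrite (dsumE S A B (fun a => a * a) expR) (dsumE S A B id (fun b => b * expR b)).
  rewrite -!(fmxM S id) !fmx_id// /retr mxtrace_sqr_diff_mul ?cE//.
  rewrite !ReCD !ReCN !ReCD.
  by move: (ReC _) (ReC _) (ReC _) (ReC _) (ReC _) (ReC _) => ? ? ? ? ? ?; ring.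
by rewrite -dsumZ; apply: dsum_le => i j; exact: expR_diff_quadratic.
Qed.

(** In the eigenbasis of A the trace is the sum of f(a_i) times the quadratic form of Q at the i-th
    eigenvector. *)
Lemma retr_psd_fmx_ge0 (Q : 'M[C]_N) f A :
  psd Q -> (forall x, 0 <= f x) -> 0 <= retr (Q *m fmx f A).
Proof.
move=> psdQ f0; rewrite fmxE /retr mxtrace_conj.
rewrite /mxtrace ReC_sum sumr_ge0// => i _; move: (spectralmx A) => U.
rewrite mul_diag_mx mxE [X in X * _]mxE ReCZ mulr_ge0//.
have := psdQ (row i U); congr (0 <= ReC _).
rewrite -row_mul mxE [RHS]mxE; apply: eq_bigr => k _.
by congr (_ * _); rewrite !mxE.
Qed.

(** The exponential is not operator monotone, but its trace is: Klein's inequality bounds the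
    difference by - tr ((B - A) e^A). *)
Lemma trexp_le A B : hermmx A -> hermmx B -> psd (B - A) -> trexp A <= trexp B.
Proof.
move=> hA hB psdBA; have := retr_psd_fmx_ge0 A psdBA (@expR_ge0 R).
have := trexp_klein hA hB; rewrite -(opprB A B) mulNmx retrN; lra.
Qed.

(** The sum of the squared eigenvalues is a crude stand-in for the squared norm of Y; what matters
    is that it does not depend on K. *)
Lemma retr_sqr_exp_le Y K : hermmx Y ->
  retr (Y *m Y *m E K) <= (\sum_j eigs Y j ^+ 2) * trexp K.
Proof.
move=> hY; rewrite retrC -{1 2}(fmx_id S hY) fmxM -dsumE /trexp.
rewrite -(dsumEl S K Y) -dsumZ; apply: dsum_le => i j /=.
rewrite mulrC ler_wpM2r ?expR_ge0// (bigD1 j)//= -expr2 lerDl sumr_ge0// => k _.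
exact: sqr_ge0.
Qed.

Section CoshBound.
Variables (H Y : 'M[C]_N).
Hypotheses (hH : hermmx H) (hY : hermmx Y).

(* The sign e = 1, -1 plays the Rademacher variable: at t = 1 only the linear
   term remains, at t = 0 only the quadratic correction. *)
Let path (e t : R) : 'M[C]_N :=
  H + ((e * t)%:C *: Y + ((1 - t ^+ 2) / 2)%:C *: (Y *m Y)).
Let phi t : R := trexp (path 1 t) + trexp (path (-1) t).
Let c : R := \sum_j eigs Y j ^+ 2.

Let herm_path e t : hermmx (path e t).
Proof. by do !apply: hermmxD => //; apply: hermmxZ => //; apply: hermmx_sqr. Qed.

Let path_diff e t e' s : path e t - path e' s =
  (e * t - e' * s)%:C *: Y + ((s ^+ 2 - t ^+ 2) / 2)%:C *: (Y *m Y).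
Proof.
have -> : (s ^+ 2 - t ^+ 2) / 2 = (1 - t ^+ 2) / 2 - (1 - s ^+ 2) / 2 :> R by field.
rewrite !r2cB !scalerBl /path; move: (Y *m Y) => Y2.
by rewrite opprD addrACA subrr add0r opprD addrACA.
Qed.

(** With a1, a2 the traces tr (Y e^path) and q1, q2 the traces tr (Y^2 e^path) at the two signs,
    Klein's inequality bounds phi t - phi s by (t - s) (a1 - a2) - (t^2 - s^2)/2 (q1 + q2). Since a1
    - a2 <= t (q1 + q2), the terms of first order in t - s cancel and (t - s)^2/2 (q1 + q2) is
    left. *)
Let phi_step (s t : R) : 0 <= s -> s < t -> phi t * (1 - c / 2 * (t - s) ^+ 2) <= phi s.
Proof.
move=> s0 st.
have kl e : trexp (path e t) - trexp (path e s) <=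
    e * (t - s) * retr (Y *m E (path e t))
    + (s ^+ 2 - t ^+ 2) / 2 * retr (Y *m Y *m E (path e t)).
  apply: le_trans (trexp_klein (herm_path e t) (herm_path e s)) _.
  by rewrite path_diff mulmxDl -!scalemxAl retrD !retrZ mulrBr.
have := trexp_diff_quadratic (herm_path 1 t) (herm_path (-1) t).
rewrite path_diff subrr mul0r r2c0 scale0r addr0.
rewrite -!scalemxAr -!scalemxAl !retrZ.
rewrite !mulmxDr mulmxN !retrD retrN.
have := kl 1; have := kl (-1).
have := retr_sqr_exp_le (path 1 t) hY; have := retr_sqr_exp_le (path (-1) t) hY.
rewrite -/c /phi.
move: (retr (Y *m E (path 1 t))) (retr (Y *m E (path (-1) t))) => a1 a2.
move: (retr (Y *m Y *m E (path 1 t))) (retr (Y *m Y *m E (path (-1) t))) => q1 q2.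
move: (trexp (path 1 t)) (trexp (path (-1) t)) => f1 f2.
move: (trexp (path 1 s)) (trexp (path (-1) s)) => g1 g2 b2 b1 k2 k1 q.
have t0 : 0 < t by lra.
(* The two paths differ by 2 t Y at time t, which puts a common factor 2 t on both sides of the
   quadratic inequality. *)
have {}q : a1 - a2 <= t * (q1 + q2).
  have t2 : 0 < 2 * t by lra.
  rewrite -(ler_pM2l t2); move: q; lra.
have : (t - s) * (a1 - a2) <= (t - s) * (t * (q1 + q2)).
  by rewrite ler_pM2l// subr_gt0.
have : (t - s) ^+ 2 / 2 * (q1 + q2) <= (t - s) ^+ 2 / 2 * (c * f2 + c * f1).
  by apply: ler_wpM2l; [rewrite divr_ge0 ?sqr_ge0|lra].
by lra.
Qed.

Lemma trexp_cosh : trexp (H + Y) + trexp (H - Y) <= 2 * trexp (H + 2^-1%:C *: (Y *m Y)).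
Proof.
have phi1 : phi 1 = trexp (H + Y) + trexp (H - Y).
  rewrite /phi /path expr1n subrr mul0r r2c0 scale0r addr0 !mulr1 r2cN r2c1.
  by rewrite scaleNr scale1r addr0.
have phi0 : phi 0 = 2 * trexp (H + 2^-1%:C *: (Y *m Y)).
  by rewrite /phi /path !mulr0 expr0n subr0 mul1r r2c0 scale0r add0r mulrDl mul1r.
rewrite -phi1 -phi0.
have phi_ge0 t : 0 <= phi t by rewrite addr_ge0 ?trexp_ge0.
have c0 : 0 <= c by apply: sumr_ge0 => i _; exact: sqr_ge0.
(* On a mesh of width 1/(n+1) each step costs a factor 1 - d with d = c / (2 (n+1)^2), and k such
   factors multiply to at least 1 - k d. The condition c <= n+1 keeps 1 - k d nonnegative. *)
have bound n k : c <= n.+1%:R -> (k <= n.+1)%N ->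
    phi (k%:R / n.+1%:R) * (1 - k%:R * (c / 2 / n.+1%:R ^+ 2)) <= phi 0.
  move=> cn; set d := c / 2 / _.
  have n0 : 0 < n.+1%:R :> R by [].
  have d0 : 0 <= d by rewrite !divr_ge0// ltW.
  elim: k => [|k IH] kn; first by rewrite !mul0r subr0 mulr1.
  apply: le_trans (IH (ltnW kn)).
  have kd : 0 <= 1 - k%:R * d.
    rewrite subr_ge0; apply: (@le_trans _ _ (n.+1%:R * d)).
      by rewrite ler_wpM2r// ler_nat ltnW.
    rewrite (_ : _ * d = c / n.+1%:R / 2).
      rewrite ler_pdivrMr// mul1r; apply: (@le_trans _ _ 1); last by rewrite ler1n.
      by rewrite ler_pdivrMr// mul1r.
    by rewrite /d; field; rewrite addrC natr1 gt_eqF.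
  have st : k%:R / n.+1%:R < k.+1%:R / n.+1%:R :> R.
      by rewrite ltr_pM2r ?invr_gt0// ltr_nat.
  have := phi_step _ st; rewrite divr_ge0// => /(_ isT).
  have -> : c / 2 * (k.+1%:R / n.+1%:R - k%:R / n.+1%:R) ^+ 2 = d.
    by rewrite -mulrBl -natrB// subSnn mul1r exprVn.
  move=> /(ler_wpM2r kd); apply: le_trans.
  rewrite -mulrA ler_wpM2l// -(natr1 k).
  have : 0 <= k%:R * d * d by rewrite !mulr_ge0.
  lra.
apply/ler_addgt0Pr => e e0.
(* [n.+1] exceeds c, as [bound] requires, and phi 1 * c / e, so that the total loss at t = 1 is at
   most e / 2. *)
pose n := Num.truncn (Num.max c (phi 1 * c / e)).
have nlt : Num.max c (phi 1 * c / e) < n.+1%:R by exact: truncnS_gt.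
have cn : c <= n.+1%:R by apply/ltW/(le_lt_trans _ nlt); rewrite le_max lexx.
have en : phi 1 * c / e <= n.+1%:R.
  by apply/ltW/(le_lt_trans _ nlt); rewrite le_max lexx orbT.
have := bound n n.+1 cn (leqnn _); rewrite divff ?pnatr_eq0//.
have -> : n.+1%:R * (c / 2 / n.+1%:R ^+ 2) = c / n.+1%:R / 2 :> R.
  by field; rewrite addrC natr1 pnatr_eq0.
have : phi 1 * (c / n.+1%:R) <= e.
  by rewrite mulrA ler_pdivrMr// [leRHS]mulrC -ler_pdivrMr.
by move: (c / n.+1%:R) (phi 1) (phi 0) => x f1 f0; lra.
Qed.

End CoshBound.

(* The factor 2 is the price of symmetrizing X, whose law need not be
   symmetric: trexp_cosh is applied to Y = 2 X. *)
Lemma trexp_square_bound H X B : hermmx H -> hermmx X -> hermmx B ->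
  psd (B - X *m X) ->
  trexp (H + X) <= trexp (H + 2%:C *: B) + retr (X *m E H).
Proof.
move=> hH hX hB leXB.
have h2 : hermmx (2%:C *: X) by exact: hermmxZ.
have hX2 : hermmx (2%:C *: (X *m X)) by apply: hermmxZ; exact: hermmx_sqr.
have h2B : hermmx (2%:C *: B) by exact: hermmxZ.
have hHX := hermmxD hH hX.
(* The linear terms of [k1] and [k2] cancel in their sum, which is midpoint convexity: 2 tr e^(H+X)
   <= tr e^(H+2X) + tr e^H. Then [k3] bounds tr e^H - tr e^(H-2X) by 2 tr (X e^H), the linear term
   that survives. *)
have k1 := trexp_klein hHX (hermmxD hH h2).
have k2 := trexp_klein hHX hH.
have k3 := trexp_klein hH (hermmxD hH (hermmxN h2)).
have cosh := trexp_cosh hH h2.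
have d1 : H + X - (H + 2%:C *: X) = - X.
  rewrite opprD addrACA subrr add0r -[X in X - _]scale1r -(r2c1 S) -scalerBl -r2cB.
  by rewrite (_ : 1 - 2 = -1)// ?r2cN ?r2c1 ?scaleN1r//; ring.
rewrite d1 mulNmx retrN in k1.
rewrite addrAC subrr add0r in k2.
rewrite opprD addrA subrr add0r opprK -scalemxAl retrZ in k3.
have sqE : 2^-1%:C *: ((2%:C *: X) *m (2%:C *: X)) = 2%:C *: (X *m X).
  by rewrite -scalemxAl -scalemxAr !scalerA -!r2cM; congr (_%:C *: _); field.
rewrite sqE in cosh.
have mono : trexp (H + 2%:C *: (X *m X)) <= trexp (H + 2%:C *: B).
  apply: trexp_le; [exact: hermmxD|exact: hermmxD|].
  move=> v; rewrite opprD addrACA subrr add0r -scalerBr.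
  rewrite -scalemxAr -scalemxAl mxE ReCZ mulr_ge0//.
move: k1 k2 k3 cosh mono; move: (retr (X *m E (H + X))) (retr (X *m E H)) => r1 r2.
by move: (trexp _) (trexp _) (trexp _) (trexp _) (trexp _) (trexp _)
  => f1 f2 f3 f4 f5 f6; lra.
Qed.

End TraceInequalities.

(** * Eigenvalues, the largest eigenvalue, and entrywise bounds *)

Section Eigenvalues.
Variables (R : realType) (C : numClosedFieldType) (S : cplx R C) (N : nat).
Local Notation ReC := (ReC S).
Local Notation ImC := (ImC S).
Local Notation "x %:C" := (r2c S x) (at level 1, format "x %:C").
Local Notation retr := (retr S).
Local Notation fmx := (fmx S).
Local Notation eigs := (eigs S).
Local Notation trexp := (trexp S).
Local Notation psd := (psd S).
Implicit Types (A B H K X Y M : 'M[C]_N) (f g : R -> R).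

Lemma spectral_decomp A : hermmx A ->
  A = (spectralmx A) ^t* *m diag_mx (\row_i (eigs A i)%:C) *m spectralmx A.
Proof. by move=> hA; rewrite -{1}(fmx_id S hA) fmxE. Qed.

Lemma eigenvalue_hermP A a : hermmx A ->
  reflect (exists i, a = (eigs A i)%:C) (eigenvalue A a).
Proof.
move=> hA; have := spectralmxK A; have := spectralmxVK A; have := spectral_decomp hA.
move: (spectralmx A) => U AE VK UK; apply: (iffP eigenvalueP).
- case=> v vA v0.
  have [u uE u0] : exists2 u : 'rV[C]_N,
      u *m diag_mx (\row_i (eigs A i)%:C) = a *: u & u != 0.
    exists (v *m U ^t*).
      by rewrite scalemxAl -vA [in RHS]AE -!mulmxA UK mulmx1.
    by apply: contra_neq v0 => u0; rewrite -(mulmx1 v) -VK mulmxA u0 mul0mx.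
  have /rV0Pn[i ui0] := u0; exists i.
  have /rowP/(_ i) := uE; rewrite mul_mx_diag !mxE => /esym/eqP.
  by rewrite mulrC (inj_eq (mulfI ui0)) => /eqP.
- case=> i ->; exists (row i U); last first.
    apply/eqP => r0; have : row i (U *m U ^t*) = 0 by rewrite row_mul r0 mul0mx.
    by rewrite UK => /rowP/(_ i)/eqP; rewrite !mxE eqxx oner_eq0.
  rewrite {1}AE !mulmxA -row_mul UK row1 -rowE.
  by apply/rowP => j; rewrite row_diag_mx -scalemxAl -rowE !mxE.
Qed.

(** The eigenbases of A and of its multiple are chosen independently, so eigenvalues are matched
    through a common eigenvector, up to an unspecified index. *)
Lemma eigs_scale (s : R) A j : hermmx A -> s != 0 ->
  exists i, eigs (s%:C *: A) j = s * eigs A i.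
Proof.
move=> hA s0; have hsA := hermmxZ S s hA.
have /(eigenvalue_hermP _ hsA)/eigenvalueP[v vE v0] :
    exists i, (eigs (s%:C *: A) j)%:C = (eigs (s%:C *: A) i)%:C.
  by exists j.
have sn0 : s%:C != 0 by rewrite -(r2c0 S) (inj_eq (@r2c_inj _ _ S)).
have : eigenvalue A (s^-1 * eigs (s%:C *: A) j)%:C.
  apply/eigenvalueP; exists v => //; apply: (scalerI sn0).
  by rewrite scalemxAr vE scalerA -r2cM mulrA divff// mul1r.
move=> /(eigenvalue_hermP _ hA)[i /(@r2c_inj _ _ S) iE]; exists i.
by rewrite -iE mulrA divff// mul1r.
Qed.

Lemma eigs_scale_ex (s : R) A i : hermmx A -> exists j, eigs (s%:C *: A) j = s * eigs A i.
Proof.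
move=> hA; have hsA := hermmxZ S s hA.
have /(eigenvalue_hermP _ hA)/eigenvalueP[v vE v0] :
    exists k, (eigs A i)%:C = (eigs A k)%:C.
  by exists i.
have : eigenvalue (s%:C *: A) (s * eigs A i)%:C.
  by apply/eigenvalueP; exists v => //; rewrite -scalemxAr vE scalerA -r2cM.
by move=> /(eigenvalue_hermP _ hsA)[j /(@r2c_inj _ _ S) jE]; exists j.
Qed.

Lemma eigs_sqr_ex A i : hermmx A -> exists j, eigs (A *m A) j = eigs A i ^+ 2.
Proof.
move=> hA; have hA2 := hermmx_sqr hA.
have /(eigenvalue_hermP _ hA)/eigenvalueP[v vE v0] :
    exists k, (eigs A i)%:C = (eigs A k)%:C.
  by exists i.
have : eigenvalue (A *m A) (eigs A i ^+ 2)%:C.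
  by apply/eigenvalueP; exists v => //; rewrite mulmxA vE -scalemxAl vE scalerA -r2cM.
by move=> /(eigenvalue_hermP _ hA2)[j /(@r2c_inj _ _ S) jE]; exists j.
Qed.

Lemma expR_eigs_le_trexp A i : expR (eigs A i) <= trexp A.
Proof.
rewrite trexpE (bigD1 i)//= lerDl sumr_ge0// => j _; exact: expR_ge0.
Qed.

Lemma trexp_le_expR A b : (forall i, eigs A i <= b) -> trexp A <= N%:R * expR b.
Proof.
move=> le_b; rewrite trexpE -[N in N%:R]card_ord mulr_natl -sumr_const.
by apply: ler_sum => i _; rewrite ler_expR.
Qed.

Definition is_lmax A l := (exists i, eigs A i = l) /\ forall i, eigs A i <= l.

Lemma expR_lmax_le_trexp A l s : hermmx A -> is_lmax A l ->
  expR (s * l) <= trexp (s%:C *: A).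
Proof.
move=> hA [[i <-] _]; have [j <-] := eigs_scale_ex s i hA.
exact: expR_eigs_le_trexp.
Qed.

Lemma trexp_le_expR_lmax A l s : hermmx A -> (forall i, eigs A i <= l) -> 0 < s ->
  trexp (s%:C *: A) <= N%:R * expR (s * l).
Proof.
move=> hA leA s0; apply: trexp_le_expR => j.
by have [i ->] := eigs_scale j hA (lt0r_neq0 s0); rewrite ler_pM2l.
Qed.

(** The factor N in e^(k l) <= tr e^(k A) <= N e^(k l) is swallowed as k grows. The point is to
    describe the event theta <= l by countably many trace exponentials, whose measurability is
    within reach. *)
Lemma le_lmaxP A l theta : hermmx A -> is_lmax A l ->
  (theta <= l) <-> (forall k : nat, expR (k%:R * theta) <= trexp (k%:R%:C *: A)).
Proof.
move=> hA lA; split=> [tl k|H].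
  by apply: le_trans (expR_lmax_le_trexp _ hA lA); rewrite ler_expR ler_wpM2l.
rewrite leNgt; apply/negP => lt.
(* This k makes k (theta - l) exceed N, while the hypothesis forces e^(k (theta - l)) <= N; this
   contradicts 1 + x <= e^x. *)
pose k := (Num.truncn (N%:R / (theta - l))).+1.
have d0 : 0 < theta - l by rewrite subr_gt0.
have := le_trans (H k) (trexp_le_expR_lmax hA lA.2 _); rewrite ltr0Sn => /(_ isT).
rewrite -ler_pdivrMr ?expR_gt0// -expRB -mulrBr leNgt => /negP; apply.
apply: lt_le_trans (expR_ge1Dx _).
have : N%:R < k%:R * (theta - l) by rewrite -ltr_pdivrMr// truncnS_gt.
by lra.
Qed.

Lemma entry_fmx f A a b : fmx f A a b =
  \sum_i (f (eigs A i))%:C * (Num.conj (spectralmx A i a) * spectralmx A i b).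
Proof.
rewrite fmxE mul_mx_diag mxE; apply: eq_bigr => i _.
by rewrite !mxE [X in X * _]mulrC -mulrA.
Qed.

Lemma Re_entry_fmx f A a b : ReC (fmx f A a b) =
  \sum_i f (eigs A i) * ReC (Num.conj (spectralmx A i a) * spectralmx A i b).
Proof. by rewrite entry_fmx ReC_sum; apply: eq_bigr => i _; rewrite ReCZ. Qed.

Lemma Im_entry_fmx f A a b : ImC (fmx f A a b) =
  \sum_i f (eigs A i) * ImC (Num.conj (spectralmx A i a) * spectralmx A i b).
Proof. by rewrite entry_fmx ImC_sum; apply: eq_bigr => i _; rewrite ImCZ. Qed.

Lemma sqr_unitary_entry (U : 'M[C]_N) i a : U *m U ^t* = 1%:M ->
  ReC (U i a) ^+ 2 + ImC (U i a) ^+ 2 <= 1.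
Proof.
move=> /matrixP/(_ i i)/(congr1 ReC); rewrite !mxE eqxx -(r2c1 S) ReC_r2c ReC_sum => <-.
rewrite (bigD1 a)//= !mxE ReCM ReC_conj ImC_conj mulrN opprK -!expr2 lerDl.
rewrite sumr_ge0// => j _.
by rewrite !mxE ReCM ReC_conj ImC_conj mulrN opprK -!expr2 addr_ge0 ?sqr_ge0.
Qed.

(** Entries of a unitary matrix have modulus at most 1, so an entry of f(A) combines the f(a_i) >= 0
    with coefficients whose real and imaginary parts lie in [-1, 1]. *)
Lemma entry_fmx_le f A a b : (forall x, 0 <= f x) ->
  `|ReC (fmx f A a b)| <= retr (fmx f A) /\ `|ImC (fmx f A a b)| <= retr (fmx f A).
Proof.
move=> f0.
rewrite retr_fmx.
have bnd i : `|ReC (Num.conj (spectralmx A i a) * spectralmx A i b)| <= 1 /\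
    `|ImC (Num.conj (spectralmx A i a) * spectralmx A i b)| <= 1.
  have := sqr_unitary_entry i a (spectralmxK A).
  have := sqr_unitary_entry i b (spectralmxK A).
  rewrite ReCM ImCM ReC_conj ImC_conj !ler_norml.
  move: (ReC (spectralmx A i a)) (ImC (spectralmx A i a)) => x y.
  move: (ReC (spectralmx A i b)) (ImC (spectralmx A i b)) => z t h1 h2.
  (* These squares supply 2 |x z| <= x^2 + z^2 and its analogues. *)
  have := sqr_ge0 (x - z); have := sqr_ge0 (y - t).
  have := sqr_ge0 (x + z); have := sqr_ge0 (y + t).
  have := sqr_ge0 (x - t); have := sqr_ge0 (y - z).
  have := sqr_ge0 (x + t); have := sqr_ge0 (y + z).
  by split; apply/andP; split; lra.
rewrite Re_entry_fmx Im_entry_fmx; split; apply: le_trans (ler_norm_sum _ _ _) _;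
  apply: ler_sum => i _; rewrite normrM (ger0_norm (f0 _)) ler_piMr//;
  by have [] := bnd i.
Qed.

Lemma hermmx_entry_sqr A a b : hermmx A ->
  ReC (A a b * A b a) = ReC (A a b) ^+ 2 + ImC (A a b) ^+ 2.
Proof.
move=> /matrixP/(_ b a); rewrite !mxE => <-.
by rewrite ReCM ReC_conj ImC_conj mulrN opprK -!expr2.
Qed.

Lemma retr_sqr A : hermmx A ->
  retr (A *m A) = \sum_a \sum_b (ReC (A a b) ^+ 2 + ImC (A a b) ^+ 2).
Proof.
move=> hA; rewrite /retr /mxtrace ReC_sum; apply: eq_bigr => a _.
by rewrite mxE ReC_sum; apply: eq_bigr => b _; rewrite hermmx_entry_sqr.
Qed.

(** An eigenvalue satisfies a <= 1 + a^2, and a^2 is at most tr A^2, the sum of the squared moduli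
    of the entries. Bounded entries thus give a bounded trace exponential. *)
Lemma trexp_le_entries A : hermmx A ->
  trexp A <= N%:R * expR (1 + \sum_a \sum_b (ReC (A a b) ^+ 2 + ImC (A a b) ^+ 2)).
Proof.
move=> hA; apply: trexp_le_expR => i; rewrite -retr_sqr//.
have -> : A *m A = fmx (fun x => x * x) A by rewrite -(fmxM S id) fmx_id.
rewrite retr_fmx (bigD1 i)//=.
have : 0 <= \sum_(j < N | j != i) eigs A j * eigs A j.
  by apply: sumr_ge0 => j _; rewrite -expr2 sqr_ge0.
have := sqr_ge0 (eigs A i - 1); have := sqr_ge0 (eigs A i).
by move: (\sum_(j < N | _) _) (eigs A i) => x y; lra.
Qed.

(** Tested at the a-th basis vector, the order bounds the diagonal entry (X^2)_aa, which is the
    squared norm of row a of X. *)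
Lemma psd_entry_sqr_le B X a b : hermmx X -> psd (B - X *m X) ->
  ReC (X a b) ^+ 2 + ImC (X a b) ^+ 2 <= ReC (B a a).
Proof.
move=> hX /(_ (delta_mx 0 a)).
have -> : (delta_mx 0 a : 'rV[C]_N) ^t* = delta_mx a 0.
  by apply/matrixP => i j; rewrite !mxE ord1 conjC_nat !eqxx andbT andTb.
rewrite -rowE -colE !mxE ReCD ReCN subr_ge0; apply: le_trans.
rewrite ReC_sum (bigD1 b)//= hermmx_entry_sqr// lerDl sumr_ge0// => j _.
by rewrite hermmx_entry_sqr// addr_ge0 ?sqr_ge0.
Qed.

End Eigenvalues.

(** * Measurability of matrix exponentials and of the eigenvalue event *)

Section Measurability.
Variables (R : realType) (C : numClosedFieldType) (S : cplx R C) (N : nat).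
Variables (d : measure_display) (T : measurableType d).
Local Notation ReC := (ReC S).
Local Notation ImC := (ImC S).
Local Notation "x %:C" := (r2c S x) (at level 1, format "x %:C").
Local Notation fmx := (fmx S).
Local Notation eigs := (eigs S).
Local Notation trexp := (trexp S).
Implicit Types (M : T -> 'M[C]_N).

Definition mxmeasurable M := forall a b,
  measurable_fun setT (fun w => ReC (M w a b)) /\
  measurable_fun setT (fun w => ImC (M w a b)).

Lemma mxmeasurable_cst (A : 'M[C]_N) : mxmeasurable (fun=> A).
Proof. by move=> a b; split; exact: measurable_cst. Qed.

Lemma mxmeasurableD M1 M2 : mxmeasurable M1 -> mxmeasurable M2 ->
  mxmeasurable (fun w => M1 w + M2 w).
Proof.
move=> m1 m2 a b; have [r1 i1] := m1 a b; have [r2 i2] := m2 a b.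
split; under eq_fun do rewrite mxE (ReCD, ImCD); exact: measurable_funD.
Qed.

Lemma mxmeasurableZ (s : R) M : mxmeasurable M -> mxmeasurable (fun w => s%:C *: M w).
Proof.
move=> m a b; have [r i] := m a b.
by split; under eq_fun do rewrite mxE (ReCZ, ImCZ); exact: measurable_funM.
Qed.

Lemma mxmeasurableM M1 M2 : mxmeasurable M1 -> mxmeasurable M2 ->
  mxmeasurable (fun w => M1 w *m M2 w).
Proof.
move=> m1 m2 a b; split; under eq_fun do rewrite mxE (ReC_sum, ImC_sum);
  apply: measurable_sum => k; have [r1 i1] := m1 a k; have [r2 i2] := m2 k b.
- by under eq_fun do rewrite ReCM; apply: measurable_funB; exact: measurable_funM.
- by under eq_fun do rewrite ImCM; apply: measurable_funD; exact: measurable_funM.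
Qed.

Lemma mxmeasurable_sum I (r : seq I) (P : pred I) (M : I -> T -> 'M[C]_N) :
  (forall i, P i -> mxmeasurable (M i)) ->
  mxmeasurable (fun w => \sum_(i <- r | P i) M i w).
Proof.
move=> mM; elim: r => [|i r IH].
  have -> : (fun w => \sum_(i <- [::] | P i) M i w) = fun=> 0.
    by apply/funext => w; rewrite big_nil.
  exact: mxmeasurable_cst.
case Pi : (P i); last first.
  have -> // : (fun w => \sum_(j <- i :: r | P j) M j w) =
      fun w => \sum_(j <- r | P j) M j w.
  by apply/funext => w; rewrite big_cons Pi.
have -> : (fun w => \sum_(j <- i :: r | P j) M j w) =
    fun w => M i w + \sum_(j <- r | P j) M j w.
  by apply/funext => w; rewrite big_cons Pi.
by apply: mxmeasurableD => //; exact: mM.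
Qed.

Section Exponential.
Variable M : T -> 'M[C]_N.
Hypotheses (hM : forall w, hermmx (M w)) (mM : mxmeasurable M).

Let mxmeasurable_fmxX k : mxmeasurable (fun w => fmx (fun x => x ^+ k) (M w)).
Proof.
elim: k => [|k IH].
  rewrite [X in mxmeasurable X](_ : _ = fun=> 1%:M); first exact: mxmeasurable_cst.
  by apply/funext => w; rewrite -(fmx1 S (M w)).
rewrite [X in mxmeasurable X](_ : _ = fun w => M w *m fmx (fun x => x ^+ k) (M w)).
  exact: mxmeasurableM.
apply/funext => w; rewrite -{2}(fmx_id S (hM w)) fmxM.
by apply: fmx_ext => i; rewrite exprS.
Qed.

Let cvg_expR_sum (c e : 'I_N -> R) :
  (\sum_i (series (exp_coeff (e i)) n) * c i) @[n --> \oo] --> \sum_i expR (e i) * c i.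
Proof.
apply: cvg_big => // [x|i _]; first exact: add_continuous.
apply: cvgM; last exact: cvg_cst.
exact: is_cvg_series_exp_coeff.
Qed.

Let series_expE n (c e : 'I_N -> R) :
  \sum_i (series (exp_coeff (e i)) n) * c i =
  \sum_(0 <= k < n) k`!%:R^-1 * \sum_i e i ^+ k * c i.
Proof.
under eq_bigr do rewrite /series /= mulr_suml.
rewrite exchange_big /=; apply: eq_bigr => k _; rewrite mulr_sumr.
by apply: eq_bigr => i _; rewrite exp_coeffE /= mulrA.
Qed.

(* The entries of the exponential are pointwise limits of polynomials in the
   entries: no measurable choice of eigenvectors is needed. *)
Lemma mxmeasurable_exp : mxmeasurable (fun w => fmx expR (M w)).
Proof.
move=> a b; split.
- apply: (@measurable_fun_cvg _ _ _ setT (fun n w =>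
    \sum_(0 <= k < n) k`!%:R^-1 * ReC (fmx (fun x => x ^+ k) (M w) a b))).
  + move=> n; apply: measurable_sum => k; apply: measurable_funM => //.
    exact: (mxmeasurable_fmxX k a b).1.
  + move=> w _; rewrite Re_entry_fmx.
    apply: (cvg_trans _ (@cvg_expR_sum (fun i => ReC (Num.conj
      (spectralmx (M w) i a) * spectralmx (M w) i b)) (eigs (M w)))).
    apply: near_eq_cvg; apply: nearW => n; rewrite series_expE.
    by apply: eq_bigr => k _; rewrite Re_entry_fmx.
- apply: (@measurable_fun_cvg _ _ _ setT (fun n w =>
    \sum_(0 <= k < n) k`!%:R^-1 * ImC (fmx (fun x => x ^+ k) (M w) a b))).
  + move=> n; apply: measurable_sum => k; apply: measurable_funM => //.
    exact: (mxmeasurable_fmxX k a b).2.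
  + move=> w _; rewrite Im_entry_fmx.
    apply: (cvg_trans _ (@cvg_expR_sum (fun i => ImC (Num.conj
      (spectralmx (M w) i a) * spectralmx (M w) i b)) (eigs (M w)))).
    apply: near_eq_cvg; apply: nearW => n; rewrite series_expE.
    by apply: eq_bigr => k _; rewrite Im_entry_fmx.
Qed.

Lemma measurable_trexp : measurable_fun setT (fun w => trexp (M w)).
Proof.
rewrite /trexp /retr /mxtrace; under eq_fun do rewrite ReC_sum.
by apply: measurable_sum => i; exact: (mxmeasurable_exp i i).1.
Qed.

End Exponential.

Lemma measurable_le_lmax M (l : T -> R) (theta : R) :
  (forall w, hermmx (M w)) -> mxmeasurable M -> (forall w, is_lmax S (M w) (l w)) ->
  measurable [set w | theta <= l w].
Proof.
move=> hM mM lM.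
have -> : [set w | theta <= l w] =
    \bigcap_(k : nat) [set w | expR (k%:R * theta) <= trexp (k%:R%:C *: M w)].
  apply/seteqP; split=> w /= => [tl k _|H].
    by move: k; apply/(le_lmaxP theta (hM w) (lM w)).
  by apply/(le_lmaxP theta (hM w) (lM w)) => k; exact: H.
apply: bigcapT_measurable => k; rewrite -[X in measurable X]setTI.
apply: measurable_fun_le => //.
apply: measurable_trexp => [w|]; [exact: hermmxZ|exact: mxmeasurableZ].
Qed.

End Measurability.

(** * Almost surely bounded factors and zero conditional mean *)

Section CondExpZero.
Variables (d : measure_display) (T : measurableType d) (R : realType).
Variable P : probability T R.
Implicit Types (f g x : T -> R) (G : set (set T)).

Definition aebounded f := exists c, {ae P, forall w, `|f w| <= c}.

Lemma aebounded_cst c : aebounded (fun=> c).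
Proof. by exists `|c|; apply: aeW => w. Qed.

Lemma aebounded_le f g : (forall w, `|f w| <= g w) -> aebounded g -> aebounded f.
Proof.
move=> fg [c gc]; exists c; apply: filterS gc => w gw.
by apply: le_trans (fg w) _; apply: le_trans (ler_norm _) gw.
Qed.

Lemma aeboundedD f g : aebounded f -> aebounded g -> aebounded (fun w => f w + g w).
Proof.
move=> [c fc] [e ge]; exists (c + e); apply: filterS2 fc ge => w fw gw.
by apply: le_trans (ler_normD _ _) _; exact: lerD.
Qed.

Lemma aeboundedM f g : aebounded f -> aebounded g -> aebounded (fun w => f w * g w).
Proof.
move=> [c fc] [e ge]; exists (c * e); apply: filterS2 fc ge => w fw gw.
by rewrite normrM; exact: ler_pM.
Qed.

Lemma aebounded_sum I (r : seq I) (F : I -> T -> R) :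
  (forall i, aebounded (F i)) -> aebounded (fun w => \sum_(i <- r) F i w).
Proof.
move=> bF; elim: r => [|i r IH].
  have -> : (fun w => \sum_(i <- [::]) F i w) = fun=> 0.
    by apply/funext => w; rewrite big_nil.
  exact: aebounded_cst.
have -> : (fun w => \sum_(j <- i :: r) F j w) = fun w => F i w + \sum_(j <- r) F j w.
  by apply/funext => w; rewrite big_cons.
exact: aeboundedD.
Qed.

Lemma aebounded_expR f : aebounded f -> aebounded (fun w => expR (f w)).
Proof.
move=> [c fc]; exists (expR c); apply: filterS fc => w fw.
by rewrite ger0_norm ?expR_ge0// ler_expR; apply: le_trans (ler_norm _) fw.
Qed.

Lemma aebounded_integrable f : measurable_fun setT f -> aebounded f ->
  P.-integrable setT (EFin \o f).
Proof.
move=> mf [c fc]; have mEf : measurable_fun setT (EFin \o f) by exact/measurable_EFinP.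
apply/integrableP; split => //.
apply: (@le_lt_trans _ _ ((Num.max c 0)%:E * P setT)%E).
  apply: integral_le_bound => //; first by rewrite lee_fin le_max lexx orbT.
  by apply: filterS fc => w fw _; rewrite /= lee_fin le_max fw.
by rewrite probability_setT mule1 ltry.
Qed.

Definition mean_zero f :=
  P.-integrable setT (EFin \o f) /\ (\int[P]_w (f w)%:E = 0)%E.

Lemma mean_zeroD f g : mean_zero f -> mean_zero g -> mean_zero (fun w => f w + g w).
Proof.
move=> [fi f0] [gi g0]; split; first exact: (integrableD measurableT fi gi).
by under eq_integral do rewrite EFinD; rewrite (integralD measurableT fi gi) f0 g0 adde0.
Qed.

Lemma mean_zeroZ (c : R) f : mean_zero f -> mean_zero (fun w => c * f w).
Proof.
move=> [fi f0]; split; first exact: (integrableZl measurableT c fi).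
by under eq_integral do rewrite EFinM; rewrite (integralZl measurableT fi) f0 mule0.
Qed.

Lemma mean_zero_sum I (r : seq I) (F : I -> T -> R) :
  (forall i, mean_zero (F i)) -> mean_zero (fun w => \sum_(i <- r) F i w).
Proof.
move=> zF; elim: r => [|i r IH].
  have -> : (fun w => \sum_(i <- [::]) F i w) = fun=> 0.
    by apply/funext => w; rewrite big_nil.
  by split; [exact: integrable0|exact: integral0].
have -> : (fun w => \sum_(j <- i :: r) F j w) = fun w => F i w + \sum_(j <- r) F j w.
  by apply/funext => w; rewrite big_cons.
exact: mean_zeroD.
Qed.

(** The sum counts the integers from 1 to n that do not exceed v, which is the floor of v. It serves
    to approximate a bounded function by indicators of its superlevel sets. *)
Lemma layer_count (v : R) n : 0 <= v -> v <= n%:R ->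
  `|v - \sum_(j < n) (j.+1%:R <= v)%R%:R| <= 1.
Proof.
move=> v0; pose s k : R := \sum_(j < k) (j.+1%:R <= v)%R%:R.
have sE k : (k%:R <= v -> s k = k%:R) /\ (v < k%:R -> v - 1 <= s k <= v).
  elim: k => [|k [IH1 IH2]].
    by rewrite /s big_ord0; split=> // vk; move: (lt_le_trans vk v0); rewrite ltxx.
  rewrite /s big_ord_recr /= -/(s k); split=> [kv|vk].
    by rewrite kv IH1 ?natr1//; apply: le_trans kv; rewrite ler_nat.
  have -> : (k.+1%:R <= v) = false by rewrite leNgt vk.
  rewrite addr0; have [kv|/IH2//] := leP k%:R v.
  by rewrite IH1// kv andbT lerBlDr natr1 ltW.
rewrite -/(s n) le_eqVlt => /predU1P[vn|vn].
  by rewrite (sE n).1 -?vn// subrr normr0.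
by have /andP[] := (sE n).2 vn; rewrite ler_norml; lra.
Qed.

Lemma measurable_wrt_comp G (h : R -> R) g :
  measurable_fun setT h -> measurable_wrt G g -> measurable_wrt G (fun w => h (g w)).
Proof.
move=> mh mg B mB; apply: (mg (h @^-1` B)).
by have := mh measurableT B mB; rewrite setTI.
Qed.

Lemma measurable_wrtS G G' g : G `<=` G' -> measurable_wrt G g -> measurable_wrt G' g.
Proof. by move=> GG' mg B /mg/GG'. Qed.

Lemma measurable_wrt_fun G g : G `<=` measurable -> measurable_wrt G g ->
  measurable_fun setT g.
Proof. by move=> Gm mg _ B mB; rewrite setTI; exact/Gm/mg. Qed.

(** Turns the sub-sigma-algebra into a measurable type, so that results about [measurable_fun] apply
    to G itself. *)
Lemma measurable_wrtP G g : sigma_algebra setT G ->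
  measurable_wrt G g <-> measurable_fun (setT : set (g_sigma_algebraType G)) g.
Proof.
move=> sG; have GE := sigma_algebra_id sG; split=> [mg _ B mB|mg B mB].
  by rewrite setTI; change (<<s G >> (g @^-1` B)); rewrite GE; exact: mg.
have := mg measurableT B mB; rewrite setTI.
by change (<<s G >> (g @^-1` B) -> G (g @^-1` B)); rewrite GE.
Qed.

Section Product.
Variables (G : set (set T)) (x : T -> R).
Hypotheses (sG : sigma_algebra setT G) (Gm : G `<=` measurable).
Hypothesis x0 : cond_exp_zero P G x.

Let xi : P.-integrable setT (EFin \o x). Proof. exact: x0.1. Qed.

Let mean_zero_indic B : G B -> mean_zero (fun w => (w \in B)%:R * x w).
Proof.
move=> GB; have mB := Gm GB.
have E : (fun w => ((w \in B)%:R * x w)%:E) = (EFin \o x) \_ B.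
  apply/funext => w; rewrite patchE; case: (w \in B) => /=.
    by rewrite mul1r.
  by rewrite mul0r.
split; first by rewrite /comp E; apply/(integrable_mkcond _ mB); exact: integrableS xi.
by rewrite E -integral_mkcond; exact: x0.2.
Qed.

(** The layer sums [s n] combine indicators of superlevel sets of u, which lie in G, so their
    products with x have mean zero. They approximate u uniformly within c / (n+1), hence the
    integral is at most c / (n+1) times E|x|. *)
Let mean_zero_mul_ge0 (c : R) u : 0 < c -> (forall w, 0 <= u w <= c) ->
  measurable_wrt G u -> mean_zero (fun w => u w * x w).
Proof.
move=> c0 uc mu.
have muT := measurable_wrt_fun Gm mu.
have bu : aebounded u.
  exists c; apply: aeW => w; have /andP[u0 uc'] := uc w.
  by rewrite ger0_norm.
have mx : measurable_fun setT x by apply/measurable_EFinP; exact: (measurable_int P xi).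
have ui : P.-integrable setT (EFin \o (fun w => u w * x w)).
  apply: (le_integrable measurableT _ _ (integrableZl measurableT c xi)).
    by apply/measurable_EFinP; exact: measurable_funM.
  move=> w _ /=; rewrite lee_fin !normrM ler_wpM2r// (ger0_norm (ltW c0)).
  by have /andP[u0 uc'] := uc w; rewrite ger0_norm.
split => //.
pose s n w : R := \sum_(j < n.+1) (c / n.+1%:R) *
  ((w \in [set w | j.+1%:R <= u w / c * n.+1%:R])%:R * x w).
have zs n : mean_zero (s n).
  apply: mean_zero_sum => j; apply: mean_zeroZ; apply: mean_zero_indic.
  have := mu [set r | j.+1%:R <= r / c * n.+1%:R]; apply.
  rewrite -[X in measurable X]setTI; apply: measurable_fun_le => //.
  by apply: measurable_funM => //; apply: measurable_funM.
have us n w : `|u w * x w - s n w| <= c / n.+1%:R * `|x w|.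
  have n0 : 0 < n.+1%:R :> R by [].
  have /andP[u0 uc'] := uc w.
  have := @layer_count (u w / c * n.+1%:R) n.+1.
  rewrite mulr_ge0 ?divr_ge0 ?(ltW c0)// => /(_ isT).
  rewrite ler_piMl ?ler_pdivrMr ?mul1r// => /(_ isT) h.
  have -> : u w * x w - s n w = c / n.+1%:R *
      (u w / c * n.+1%:R - \sum_(j < n.+1) (j.+1%:R <= u w / c * n.+1%:R)%R%:R) * x w.
    rewrite mulrBr mulrBl; congr (_ - _).
      by field; rewrite gt_eqF// addrC natr1 gt_eqF.
    rewrite /s mulr_sumr mulr_suml; apply: eq_bigr => j _.
    by rewrite mulrA; congr (_ * _ * _); congr ((nat_of_bool _)%:R); rewrite mem_setE.
  have cn0 : 0 <= c / n.+1%:R by rewrite divr_ge0// ltW.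
  by rewrite normrM ler_wpM2r// normrM (ger0_norm cn0) ler_piMr.
have [K KE] : exists K, (\int[P]_w `|(x w)%:E| = K%:E)%E.
  by exists (fine (\int[P]_w `|(x w)%:E|)%E); rewrite fineK//;
    exact/integrable_fin_num/integrable_abse.
have bnd n : (`|\int[P]_w (u w * x w)%:E| <= (c / n.+1%:R * K)%:E)%E.
  have -> : (\int[P]_w (u w * x w)%:E = \int[P]_w (u w * x w - s n w)%:E)%E.
    under [RHS]eq_integral do rewrite EFinB.
    by rewrite (integralB measurableT ui (zs n).1) (zs n).2 sube0.
  have di : P.-integrable setT (fun w => (u w * x w - s n w)%:E).
    exact: (integrableB measurableT ui (zs n).1).
  apply: le_trans (le_abse_integral _ measurableT (measurable_int P di)) _.
  rewrite EFinM -KE -(integralZl measurableT (integrable_abse xi)).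
  apply: ge0_le_integral => //.
  - by apply: measurableT_comp => //; exact: (measurable_int P di).
  - exact: (measurable_int P (integrableZl measurableT _ (integrable_abse xi))).
  - by move=> w _; rewrite /= -EFinM lee_fin us.
have K0 : 0 <= K by rewrite -lee_fin -KE integral_ge0.
apply/eqP; rewrite -abse_eq0 eq_le abse_ge0 andbT.
have [r rE] : exists r, (`|\int[P]_w (u w * x w)%:E| = r%:E)%E.
  exists (fine `|\int[P]_w (u w * x w)%:E|%E); rewrite fineK// abse_fin_num.
  exact: integrable_fin_num.
rewrite rE lee_fin; apply/ler_addgt0Pl => e e0; rewrite addr0.
pose n := Num.truncn (c * K / e).
have := bnd n; rewrite rE lee_fin => /le_trans; apply.
rewrite mulrAC ler_pdivrMr// [leRHS]mulrC -ler_pdivrMr//.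
exact/ltW/truncnS_gt.
Qed.

(** The pull-out property of conditional expectation, in the case of zero conditional mean. *)
Lemma cond_exp_zero_mul g : measurable_wrt G g -> aebounded g ->
  mean_zero (fun w => g w * x w).
Proof.
move=> mg [c gc].
have mx : measurable_fun setT x by apply/measurable_EFinP; exact: (measurable_int P xi).
have mgT := measurable_wrt_fun Gm mg.
pose b := `|c| + 1; have b0 : 0 < b by rewrite ltr_wpDl.
(* As g is bounded only almost everywhere, it is truncated to [-b, b] and shifted into [0, 2b];
   subtracting b x, itself of mean zero, undoes the shift. *)
pose clamp (r : R) := Num.min (Num.max r (- b)) b + b.
have mclamp : measurable_fun setT clamp.
  apply: measurable_funD => //; apply: measurable_minr => //.
  by apply: measurable_maxr.
have clampb r : 0 <= clamp r <= 2 * b.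
  rewrite /clamp; have := ge_min b (Num.max r (- b)) b.
  have : - b <= Num.min (Num.max r (- b)) b by rewrite le_min le_max lexx orbT; lra.
  by rewrite lexx orbT => h1 h2; apply/andP; split; lra.
have b20 : 0 < 2 * b by lra.
have zu := mean_zero_mul_ge0 b20 (fun w => clampb (g w)) (measurable_wrt_comp mclamp mg).
have zx : mean_zero x.
  by split => //; apply: x0.2; have [G0 GC _] := sG; rewrite -(setD0 setT); exact: GC.
have [zi z0] := mean_zeroD zu (mean_zeroZ (- b) zx).
have mgx : measurable_fun setT (EFin \o (fun w => g w * x w)).
  by apply/measurable_EFinP; exact: measurable_funM.
have aeE : ae_eq P setT (EFin \o (fun w => clamp (g w) * x w + - b * x w))
    (EFin \o (fun w => g w * x w)).
  apply: filterS gc => w gw _ /=; congr EFin.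
  have gb : - b <= g w <= b.
    rewrite -ler_norml; apply: le_trans gw _; rewrite /b.
    by have := ler_norm c; lra.
  rewrite /clamp (max_idPl _) ?(min_idPl _); [ring|lra|lra].
have mci := measurable_int P zi.
split.
  apply/integrableP; split => //; have /integrableP[_] := zi; apply: le_lt_trans.
  apply: ae_ge0_le_integral => //; [exact: measurableT_comp|exact: measurableT_comp|].
  by apply: filterS aeE => w /[apply] ->.
by rewrite -z0; apply/esym; exact: ae_eq_integral.
Qed.

End Product.

End CondExpZero.

(** * Azuma's inequality for Hermitian random matrices *)

Section MatrixAzuma.
Variables (R : realType) (C : numClosedFieldType) (S : cplx R C) (N : nat).
Variables (d : measure_display) (T : measurableType d) (P : probability T R).
Local Notation ReC := (ReC S).
Local Notation ImC := (ImC S).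
Local Notation "x %:C" := (r2c S x) (at level 1, format "x %:C").
Local Notation retr := (retr S).
Local Notation fmx := (fmx S).
Local Notation eigs := (eigs S).
Local Notation trexp := (trexp S).
Local Notation psd := (psd S).
Local Notation mxmeasurable := (mxmeasurable S).
Implicit Types (H X M : T -> 'M[C]_N) (B : 'M[C]_N) (G : set (set T)).

Definition mxaebounded M := forall a b,
  aebounded P (fun w => ReC (M w a b)) /\ aebounded P (fun w => ImC (M w a b)).

Definition mxmeasurable_wrt G M := forall a b,
  measurable_wrt G (fun w => ReC (M w a b)) /\
  measurable_wrt G (fun w => ImC (M w a b)).

Definition mxcond_exp_zero G M := forall a b,
  cond_exp_zero P G (fun w => ReC (M w a b)) /\
  cond_exp_zero P G (fun w => ImC (M w a b)).

Lemma mxmeasurable_wrtP G M : sigma_algebra setT G ->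
  mxmeasurable_wrt G M <-> mxmeasurable (M : g_sigma_algebraType G -> 'M[C]_N).
Proof.
move=> sG; split=> mM a b; have [r i] := mM a b; split.
- exact/(measurable_wrtP _ sG).
- exact/(measurable_wrtP _ sG).
- exact/(measurable_wrtP _ sG).
- exact/(measurable_wrtP _ sG).
Qed.

Lemma mxmeasurable_wrt_mxmeasurable G M :
  G `<=` measurable -> mxmeasurable_wrt G M -> mxmeasurable M.
Proof.
by move=> Gm mM a b; have [r i] := mM a b; split; exact: (measurable_wrt_fun Gm).
Qed.

Lemma mxaebounded_cst B : mxaebounded (fun=> B).
Proof. by move=> a b; split; exact: aebounded_cst. Qed.

Lemma mxaeboundedZ (s : R) M : mxaebounded M -> mxaebounded (fun w => s%:C *: M w).
Proof.
move=> m a b; have [r i] := m a b; have bs := aebounded_cst P s.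
split; under eq_fun do rewrite mxE (ReCZ, ImCZ); exact: aeboundedM.
Qed.

Lemma mxaebounded_sum I (r : seq I) (Q : pred I) (M : I -> T -> 'M[C]_N) :
  (forall i, Q i -> mxaebounded (M i)) ->
  mxaebounded (fun w => \sum_(i <- r | Q i) M i w).
Proof.
move=> bM a b; split.
- under eq_fun do rewrite summxE ReC_sum big_mkcond.
  apply: aebounded_sum => i; case Qi : (Q i); last exact: aebounded_cst.
  exact: (bM i Qi a b).1.
- under eq_fun do rewrite summxE ImC_sum big_mkcond.
  apply: aebounded_sum => i; case Qi : (Q i); last exact: aebounded_cst.
  exact: (bM i Qi a b).2.
Qed.

Lemma mxaebounded_psd X B : (forall w, hermmx (X w)) ->
  {ae P, forall w, psd (B - X w *m X w)} -> mxaebounded X.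
Proof.
move=> hX le a b.
have sq_le (x c : R) : x ^+ 2 <= c -> `|x| <= 1 + c.
  by have := sqr_ge0 (x - 1); have := sqr_ge0 (x + 1); rewrite ler_norml; lra.
split; exists (1 + ReC (B a a)); apply: filterS le => w le;
  have := psd_entry_sqr_le a b (hX w) le; move=> h; apply: sq_le;
  apply: le_trans h; by rewrite ?lerDl ?lerDr sqr_ge0.
Qed.

Lemma aebounded_trexp H : (forall w, hermmx (H w)) -> mxaebounded H ->
  aebounded P (fun w => trexp (H w)).
Proof.
move=> hH bH.
apply: (@aebounded_le _ _ _ _ _ (fun w => N%:R * expR (1 +
  \sum_a \sum_b (ReC (H w a b) ^+ 2 + ImC (H w a b) ^+ 2)))).
  by move=> w; rewrite ger0_norm ?trexp_ge0// trexp_le_entries.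
apply: aeboundedM; first exact: aebounded_cst.
apply: aebounded_expR; apply: aeboundedD; first exact: aebounded_cst.
apply: aebounded_sum => a; apply: aebounded_sum => b; have [r i] := bH a b.
by apply: aeboundedD; under eq_fun do rewrite expr2; exact: aeboundedM.
Qed.

Lemma mxaebounded_exp H : (forall w, hermmx (H w)) -> mxaebounded H ->
  mxaebounded (fun w => fmx expR (H w)).
Proof.
move=> hH bH a b; have bt := aebounded_trexp hH bH.
split; apply: aebounded_le bt => w; have [] := entry_fmx_le S (H w) a b (@expR_ge0 R);
  by [].
Qed.

(** For Y = e^H each summand is a product of a past-measurable entry and an entry of X, to which the
    pull-out property applies. *)
Lemma retr_mulE (X Y : 'M[C]_N) : retr (X *m Y) =
  \sum_a \sum_b (ReC (Y b a) * ReC (X a b) + (-1) * (ImC (Y b a) * ImC (X a b))).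
Proof.
rewrite /retr /mxtrace ReC_sum; apply: eq_bigr => a _.
rewrite mxE ReC_sum; apply: eq_bigr => b _; rewrite ReCM; ring.
Qed.

Section Step.
Variables (G : set (set T)) (H X : T -> 'M[C]_N) (B : 'M[C]_N).
Hypotheses (sG : sigma_algebra setT G) (Gm : G `<=` measurable).
Hypotheses (hH : forall w, hermmx (H w)) (hX : forall w, hermmx (X w)) (hB : hermmx B).
Hypotheses (mH : mxmeasurable_wrt G H) (bH : mxaebounded H).
Hypotheses (mX : mxmeasurable X) (X0 : mxcond_exp_zero G X).
Hypothesis XB : {ae P, forall w, psd (B - X w *m X w)}.

Let mean_zero_linear : mean_zero P (fun w => retr (X w *m fmx expR (H w))).
Proof.
under eq_fun do rewrite retr_mulE.
have mE : mxmeasurable_wrt G (fun w => fmx expR (H w)).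
  apply/(mxmeasurable_wrtP _ sG).
  by apply: mxmeasurable_exp => //; apply/(mxmeasurable_wrtP _ sG).
have bE := mxaebounded_exp hH bH.
apply: mean_zero_sum => a; apply: mean_zero_sum => b.
have [mr mi] := mE b a; have [br bi] := bE b a; have [Xr Xi] := X0 a b.
apply: mean_zeroD; [|apply: mean_zeroZ].
  exact: (cond_exp_zero_mul sG Gm Xr mr br).
exact: (cond_exp_zero_mul sG Gm Xi mi bi).
Qed.

Lemma integral_trexp_step :
  (\int[P]_w (trexp (H w + X w))%:E <= \int[P]_w (trexp (H w + 2%:C *: B))%:E)%E.
Proof.
have mHT := mxmeasurable_wrt_mxmeasurable Gm mH.
have hHB w : hermmx (H w + 2%:C *: B) by apply: hermmxD => //; exact: hermmxZ.
have mf : measurable_fun setT (fun w => trexp (H w + X w)).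
  by apply: measurable_trexp => [w|]; [apply: hermmxD|exact: mxmeasurableD].
have mg : measurable_fun setT (fun w => trexp (H w + 2%:C *: B)).
  by apply: measurable_trexp => //; apply: mxmeasurableD => //; exact: mxmeasurable_cst.
have bHB : mxaebounded (fun w => H w + 2%:C *: B).
  move=> a b; have [r i] := bH a b.
  by split; under eq_fun do rewrite mxE (ReCD, ImCD);
    apply: aeboundedD => //; exact: aebounded_cst.
have gi := aebounded_integrable mg (aebounded_trexp hHB bHB).
have [Li L0] := mean_zero_linear.
(* Adding the mean-zero linear term leaves the integral unchanged and produces the right-hand side
   of the pointwise bound. *)
have E : (\int[P]_w (trexp (H w + 2%:C *: B))%:E =
    \int[P]_w (trexp (H w + 2%:C *: B) + retr (X w *m fmx expR (H w)))%:E)%E.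
  under [RHS]eq_integral do rewrite EFinD.
  by rewrite (integralD measurableT gi Li) L0 adde0.
have gLi := integrableD measurableT gi Li.
have aele : {ae P, forall w, trexp (H w + X w) <=
    trexp (H w + 2%:C *: B) + retr (X w *m fmx expR (H w))}.
  by apply: filterS XB => w; exact: trexp_square_bound.
rewrite E.
(* The pointwise bound, and with it nonnegativity of its right-hand side, holds only almost
   everywhere; [h] is nonnegative everywhere. *)
pose h w : R := Num.max 0 (trexp (H w + 2%:C *: B) + retr (X w *m fmx expR (H w))).
have mL := measurable_int P gLi.
have mh : measurable_fun setT (EFin \o h).
  apply/measurable_EFinP; apply: measurable_maxr => //.
  exact/measurable_EFinP.
have -> : (\int[P]_w (trexp (H w + 2%:C *: B) + retr (X w *m fmx expR (H w)))%:E =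
    \int[P]_w (h w)%:E)%E.
  apply: ae_eq_integral => //; apply: filterS aele => w le _ /=.
  by rewrite /h (max_idPr _)//; apply: le_trans le; exact: trexp_ge0.
apply: ae_ge0_le_integral => //.
- by move=> w _; rewrite lee_fin trexp_ge0.
- exact/measurable_EFinP.
- by move=> w _; rewrite lee_fin le_max lexx.
- by apply: filterS aele => w le _; rewrite lee_fin /h le_max le orbT.
Qed.

End Step.

Section Azuma.
Variables (n : nat) (F : nat -> set (set T)).
Variables (M : 'I_n -> T -> 'M[C]_N) (B : 'I_n -> 'M[C]_N).
Hypothesis filtF : filtration n F.
Hypotheses (hM : forall i w, hermmx (M i w)) (hB : forall i, hermmx (B i)).
Hypothesis mM : forall i : 'I_n, mxmeasurable_wrt (F i.+1) (M i).
Hypothesis M0 : forall i : 'I_n, mxcond_exp_zero (F i) (M i).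
Hypothesis MB : forall i, {ae P, forall w, psd (B i - M i w *m M i w)}.

Section Supermartingale.
Variable s : R.

(** At stage k the summands of index below k are random and the others are replaced by their
    deterministic corrections. Stage 0 is constant, stage n is the full random sum, and one step
    exchanges a single index. *)
Let term (k : nat) (i : 'I_n) w : 'M[C]_N :=
  if (i < k)%N then s%:C *: M i w else (2 * s ^+ 2)%:C *: B i.
Let total k w := \sum_i term k i w.

Let integral_total_step k : (k < n)%N ->
  (\int[P]_w (trexp (total k.+1 w))%:E <= \int[P]_w (trexp (total k w))%:E)%E.
Proof.
move=> kn; pose i0 := Ordinal kn.
have [sF Fm] := filtF.1 k (ltnW kn).
(* The part common to stages k and k+1. It is F k-measurable: an index i < k gives F i.+1 included
   in F k, and the terms beyond k are constant. *)
pose H w := \sum_(i | i != i0) term k i w.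
have hterm k' i w : hermmx (term k' i w).
  by rewrite /term; case: ifP => _; exact: hermmxZ.
have E1 w : total k.+1 w = H w + s%:C *: M i0 w.
  rewrite /total (bigD1 i0)//= /term ltnSn addrC; congr (_ + _).
  apply: eq_bigr => i ii0; rewrite ltnS leq_eqVlt.
  by rewrite (_ : (i == k :> nat) = false)//; apply/negbTE.
have E0 w : total k w = H w + 2%:C *: ((s ^+ 2)%:C *: B i0).
  by rewrite /total (bigD1 i0)//= {1}/term ltnn addrC scalerA -r2cM.
under eq_integral do rewrite E1.
under [leRHS]eq_integral do rewrite E0.
have hH w : hermmx (H w) by exact: hermmx_sum.
have mT i : mxmeasurable (M i).
  by have [_ Fim] := filtF.1 _ (ltn_ord i); exact: mxmeasurable_wrt_mxmeasurable (mM i).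
apply: (@integral_trexp_step (F k)) => //.
- by move=> w; exact: hermmxZ.
- exact: hermmxZ.
- apply/(mxmeasurable_wrtP _ sF); apply: mxmeasurable_sum => i _.
  rewrite /term; case ik : (i < k)%N; last exact: mxmeasurable_cst.
  apply: mxmeasurableZ; apply/(mxmeasurable_wrtP _ sF) => a b.
  have FF : F i.+1 `<=` F k by apply: filtF.2; rewrite ik ltnW.
  by have [r j] := mM i a b; split; exact: (measurable_wrtS FF).
- apply: mxaebounded_sum => i _; rewrite /term; case ik : (i < k)%N.
    by apply: mxaeboundedZ; exact: mxaebounded_psd (hM i) (MB i).
  exact: mxaebounded_cst.
- exact: mxmeasurableZ.
- move=> a b; have [[ri r0] [ii i0']] := M0 i0 a b.
  split; split.
  + by under eq_fun do rewrite mxE ReCZ EFinM; exact: integrableZl.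
  + move=> D FD; under eq_integral do rewrite mxE ReCZ EFinM.
    rewrite integralZl ?r0 ?mule0//; first exact: Fm.
    by apply: integrableS ri => //; exact: Fm.
  + by under eq_fun do rewrite mxE ImCZ EFinM; exact: integrableZl.
  + move=> D FD; under eq_integral do rewrite mxE ImCZ EFinM.
    rewrite integralZl ?i0' ?mule0//; first exact: Fm.
    by apply: integrableS ii => //; exact: Fm.
- apply: filterS (MB i0) => w le v.
  have -> : (s ^+ 2)%:C *: B i0 - s%:C *: M i0 w *m (s%:C *: M i0 w) =
      (s ^+ 2)%:C *: (B i0 - M i0 w *m M i0 w).
    by rewrite -scalemxAr -scalemxAl scalerA -r2cM -expr2 scalerBr.
  by rewrite -scalemxAr -scalemxAl mxE ReCZ mulr_ge0 ?sqr_ge0.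
Qed.

Lemma integral_trexp_sum_le :
  (\int[P]_w (trexp (s%:C *: \sum_i M i w))%:E <=
   (trexp ((2 * s ^+ 2)%:C *: \sum_i B i))%:E)%E.
Proof.
have En w : total n w = s%:C *: \sum_i M i w.
  by rewrite scaler_sumr; apply: eq_bigr => i _; rewrite /term ltn_ord.
have E0 w : total 0 w = (2 * s ^+ 2)%:C *: \sum_i B i.
  by rewrite scaler_sumr; apply: eq_bigr => i _; rewrite /term ltn0.
have -> : (trexp ((2 * s ^+ 2)%:C *: \sum_i B i))%:E =
    (\int[P]_w (trexp (total 0 w))%:E)%E.
  under eq_integral do rewrite E0.
  transitivity ((trexp ((2 * s ^+ 2)%:C *: \sum_i B i))%:E * P setT)%E.
    by rewrite probability_setT mule1.
  by apply/esym; exact: (integral_cst P measurableT).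
under eq_integral do rewrite -En.
have : (n <= n)%N by [].
(* Induction on the stage, for all k up to n. *)
elim: {-2}n => [//|k IH] kn.
exact: le_trans (integral_total_step kn) (IH (ltnW kn)).
Qed.

End Supermartingale.

Variables (l : T -> R) (sigma theta : R).
Hypothesis lE : forall w, is_lmax S (\sum_i M i w) (l w).
Hypothesis sigmaB : forall j, eigs (\sum_i B i) j <= sigma.

(** Here [sigma] stands for the sigma^2 of the theorem, and may be any nonnegative upper bound of
    the eigenvalues of the sum of the B_i. *)
Lemma matrix_azuma : (0 < N)%N -> 0 <= sigma -> 0 <= theta ->
  (P [set w | (theta <= l w)%R] <= (N%:R * expR (- theta ^+ 2 / (8 * sigma)))%:E)%E.
Proof.
move=> N0 sigma0 theta0.
have hS w : hermmx (\sum_i M i w) by exact: hermmx_sum.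
have hSB : hermmx (\sum_i B i) by exact: hermmx_sum.
have mS : mxmeasurable (fun w => \sum_i M i w).
  apply: mxmeasurable_sum => i _; have [_ Fim] := filtF.1 _ (ltn_ord i).
  exact: mxmeasurable_wrt_mxmeasurable (mM i).
have mA := measurable_le_lmax theta hS mS lE.
(* If sigma or theta is 0, the exponent is 0, division by zero being 0, and the bound is at least 1
   because N >= 1. *)
have [z|] := boolP ((sigma == 0) || (theta == 0)).
  have -> : - theta ^+ 2 / (8 * sigma) = 0.
    by case/orP: z => /eqP ->; rewrite ?mulr0 ?invr0 ?mulr0// expr0n oppr0 mul0r.
  by rewrite expR0 mulr1; apply: le_trans (probability_le1 P mA) _; rewrite lee_fin ler1n.
rewrite negb_or => /andP[sn0 tn0].
have {sn0}sp : 0 < sigma by rewrite lt0r sn0.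
have {tn0}tp : 0 < theta by rewrite lt0r tn0.
(* The minimizer of 2 s^2 sigma - s theta. *)
pose s := theta / (4 * sigma); have s0 : 0 < s by rewrite divr_gt0// mulr_gt0.
have mt : measurable_fun setT (fun w => trexp (s%:C *: \sum_i M i w)).
  by apply: measurable_trexp => [w|]; [exact: hermmxZ|exact: mxmeasurableZ].
have markov : ((expR (s * theta))%:E * P [set w | (theta <= l w)%R] <=
    \int[P]_w (trexp (s%:C *: \sum_i M i w))%:E)%E.
  have -> : ((expR (s * theta))%:E * P [set w | (theta <= l w)%R] =
      \int[P]_(w in [set w | (theta <= l w)%R]) (expR (s * theta))%:E)%E.
    by apply/esym; exact: (integral_cst P mA).
  apply: (@le_trans _ _ (\int[P]_(w in [set w | (theta <= l w)%R])
      (trexp (s%:C *: \sum_i M i w))%:E)%E).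
    apply: ge0_le_integral => //.
    - by apply/measurable_EFinP; exact: measurable_funS mt.
    - move=> w /= tl; rewrite lee_fin.
      apply: le_trans (expR_lmax_le_trexp s (hS w) (lE w)).
      by rewrite ler_expR ler_pM2l.
  apply: ge0_subset_integral => //; first exact/measurable_EFinP.
  by move=> w _; rewrite lee_fin trexp_ge0.
have s20 : 0 < 2 * s ^+ 2 by rewrite mulr_gt0 ?exprn_gt0.
have := le_trans markov (integral_trexp_sum_le s).
have [q ->] : exists q, P [set w | theta <= l w] = q%:E.
  by exists (fine (P [set w | theta <= l w])); rewrite fineK// fin_num_measure.
rewrite -EFinM !lee_fin => /le_trans /(_ (trexp_le_expR_lmax hSB sigmaB s20)).
rewrite mulrC -ler_pdivlMr ?expR_gt0// -mulrA -expRB.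
suff -> : 2 * s ^+ 2 * sigma - s * theta = - theta ^+ 2 / (8 * sigma) by [].
by rewrite /s; field; rewrite gt_eqF.
Qed.

End Azuma.

End MatrixAzuma.

(** * Block circulant matrices and the T-product *)

Section BlockCirculant.
Variables (R : rcfType) (m p : nat).
Implicit Types (A B : tensor R m p) (r s t : 'I_p).

(** Case form of subtraction modulo p, which [lia] can handle. *)
Lemma submodE r s : submod r s = (if (s <= r)%N then r - s else r + p - s)%N :> nat.
Proof.
have rp := ltn_ord r; have sp := ltn_ord s; rewrite /=; case: leqP => sr.
  by rewrite (_ : r + p - s = r - s + p)%N ?modnDr ?modn_small; lia.
by rewrite modn_small; lia.
Qed.

Lemma submod_sub r s t : submod (submod r t) (submod s t) = submod r s.
Proof.
apply: ord_inj; rewrite !submodE.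
have rp := ltn_ord r; have sp := ltn_ord s; have tp := ltn_ord t.
by case: (leqP t r) => ?; case: (leqP t s) => ?; case: (leqP s r) => ?;
  case: leqP => ?; lia.
Qed.

Lemma submod_inj t : injective (fun r : 'I_p => submod r t).
Proof.
move=> r s /(congr1 (@nat_of_ord p)); rewrite !submodE => e; apply: ord_inj; move: e.
have rp := ltn_ord r; have sp := ltn_ord s; have tp := ltn_ord t.
by case: (leqP t r) => ?; case: (leqP t s) => ?; lia.
Qed.

Lemma negmod_submod r s : negmod (submod r s) = submod s r.
Proof.
apply: ord_inj; rewrite [RHS]submodE.
have -> : negmod (submod r s) = ((p - submod r s) %% p)%N :> nat by [].
rewrite submodE.
have rp := ltn_ord r; have sp := ltn_ord s; case: leqP => ?; case: leqP => ?.
- have -> : nat_of_ord r = s by lia.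
  by rewrite !subnn subn0 modnn.
- by rewrite modn_small; lia.
- by rewrite modn_small; lia.
- by lia.
Qed.

Lemma bcircD A B : bcirc (A + B) = bcirc A + bcirc B.
Proof. by apply/matrixP => a b; rewrite !mxE ffunE mxE. Qed.

Lemma bcircN A : bcirc (- A) = - bcirc A.
Proof. by apply/matrixP => a b; rewrite !mxE ffunE mxE. Qed.

Lemma bcirc0 : bcirc (0 : tensor R m p) = 0.
Proof. by apply/matrixP => a b; rewrite !mxE ffunE mxE. Qed.

Lemma bcirc_sum I (l : seq I) (F : I -> tensor R m p) :
  bcirc (\sum_(i <- l) F i) = \sum_(i <- l) bcirc (F i).
Proof. by apply: (big_morph _ bcircD bcirc0). Qed.

(** Block (r, s) of the square is the sum over t of A_(r-t) A_(t-s); the substitution j = t - s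
    makes it the convolution at r - s. *)
Lemma bcirc_tsq A : bcirc (tsq A) = bcirc A *m bcirc A.
Proof.
rewrite /bcirc mul_mxblock; apply: eq_mxblock => r s.
rewrite ffunE (reindex_inj (@submod_inj s)) /=; apply: eq_bigr => t _.
by rewrite submod_sub.
Qed.

(** Conjugate transposition moves block (s, r) to (r, s), and its slice s - r is the negation of r -
    s that [tconjT] selects. *)
Lemma bcirc_conjT A : thermitian A -> map_mx Num.conj (bcirc A)^T = bcirc A.
Proof.
move=> hA; apply/matrixP => a b; rewrite !mxE -[in RHS]hA ffunE !mxE.
by rewrite negmod_submod.
Qed.

Lemma bcirc_dim : (\sum_(r < p) m = m * p)%N.
Proof. by rewrite sum_nat_const card_ord mulnC. Qed.

End BlockCirculant.

(** * The concrete complex numbers and the tensor inequality *)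

Section ComplexInstance.
Variable R : realType.

(** Kept transparent so that the abstract parts compute to [complex.Re] and [complex.Im], which the
    definitions on tensors use. *)
Definition complex_cplx : cplx R R[i].
Proof.
exists (@complex.Re R) (@complex.Im R) (fun x => Complex x 0).
- by case=> ? ? [].
- by case=> ? ? [].
- by case=> ? ? [].
- by case=> ? ? [].
- by case.
- by case.
- by [].
- by [].
- by case=> a b [c d] /= -> ->.
- by case=> a b; rewrite lecE /= => /andP[/eqP-> ->].
Defined.

(** The eigenvalues are the finitely many reals [eigs], so the supremum is attained. *)
Lemma lambda_max_is_lmax N (M : 'M[R[i]]_N) : (0 < N)%N -> hermmx M ->
  is_lmax complex_cplx M (lambda_max M).
Proof.
move=> N0 hM; rewrite /lambda_max.
have -> : [set complex.Re a | a in [set a | eigenvalue M a]] =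
    [set eigs complex_cplx M i | i in [set: 'I_N]].
  apply/seteqP; split=> [_ [a /= /(eigenvalue_hermP complex_cplx _ hM)[i ->] <-]|_ [i _ <-]].
    by exists i.
  exists (r2c complex_cplx (eigs complex_cplx M i)) => //=.
  by apply/(eigenvalue_hermP complex_cplx _ hM); exists i.
pose e := eigs complex_cplx M.
have [i0 _ imax] := @arg_maxP _ R 'I_N (Ordinal N0) xpredT e isT.
have ub : ubound [set e i | i in [set: 'I_N]] (e i0).
  by move=> _ [i _ <-]; exact: imax.
have -> : sup [set e i | i in [set: 'I_N]] = e i0.
  apply/eqP; rewrite eq_le; apply/andP; split.
    by apply: ge_sup => //; exists (e i0), i0.
  by apply: ub_le_sup; [exists (e i0)|exists i0].
by split=> [|i]; [exists i0|exact: imax].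
Qed.

(** The square of an eigenvalue of M is an eigenvalue of M M, which for Hermitian M is the matrix
    under the square root in [opnorm]. *)
Lemma eigs_le_opnorm N (M : 'M[R[i]]_N) i : hermmx M ->
  eigs complex_cplx M i <= opnorm M.
Proof.
move=> hM; have N0 : (0 < N)%N by case: N M i hM => // ? [].
have [j jE] := eigs_sqr_ex complex_cplx i hM.
have [_ /(_ j)] := lambda_max_is_lmax N0 (hermmx_sqr hM).
have -> : opnorm M = Num.sqrt (lambda_max (M *m M)).
  rewrite /opnorm.
  congr (Num.sqrt (lambda_max (_ *m M))).
  exact: hM.
rewrite jE.
move: (lambda_max _) (eigs _ _ _) => L x le.
apply: le_trans (ler_norm x) _.
by rewrite -sqrtr_sqr ler_wsqrtr.
Qed.

End ComplexInstance.

(* X i (i : 'I_n) is the paper's X_{i+1}: F_{i+1}-measurable, E[X | F_i] = O *)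
Theorem theorem11 (R : realType) (d : measure_display) (T : measurableType d)
  (P : probability T R) (m p n : nat) (F : nat -> set (set T))
  (X : 'I_n -> T -> tensor R m p) (A : 'I_n -> tensor R m p) :
  (0 < m)%N -> (0 < p)%N -> (0 < n)%N ->
  filtration n F ->
  (forall i : 'I_n, tmeasurable_wrt (F i.+1) (X i)) ->
  (forall (i : 'I_n) (w : T), thermitian (X i w)) ->
  (forall i : 'I_n, thermitian (A i)) ->
  (forall i : 'I_n, tcond_exp_zero P (F i) (X i)) ->
  (forall i : 'I_n, {ae P, forall w, tle (tsq (X i w)) (tsq (A i))}) ->
  forall theta : R, 0 <= theta ->
  (P [set w | (theta <= tlambda_max (\sum_(i < n) X i w))%R] <=
   ((m * p)%:R * expR (- theta ^+ 2 / (8 * tnorm (\sum_(i < n) tsq (A i)))))%:E)%E.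
Proof.
move=> m0 p0 n0 filtF mX hX hA X0 XA theta theta0.
have N0 : (0 < \sum_(r < p) m)%N by rewrite bcirc_dim muln_gt0 m0.
have hM i w : hermmx (bcirc (X i w)) by exact: bcirc_conjT.
have hB i : hermmx (bcirc (tsq (A i))).
  by rewrite bcirc_tsq; apply: hermmx_sqr; exact: bcirc_conjT.
rewrite -bcirc_dim /tnorm /tlambda_max.
apply: (@matrix_azuma R R[i] (complex_cplx R) _ d T P n F
  (fun i w => bcirc (X i w)) (fun i => bcirc (tsq (A i))) filtF) => //.
- by move=> i a b; rewrite /bcirc; split; under eq_fun do rewrite !mxE; apply mX.
- by move=> i a b; split; under eq_fun do rewrite !mxE; apply X0.
- move=> i; apply: filterS (XA i) => w le v; have := le v.
  (* In [R[i]] the order 0 <= z means that z is real and nonnegative; [psd] asks for the real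
     part. *)
  by rewrite bcircD bcircN !bcirc_tsq lecE => /andP[_].
- move=> w; rewrite bcirc_sum; apply: lambda_max_is_lmax => //.
  by apply: hermmx_sum => i _; exact: hM.
- move=> j; rewrite bcirc_sum; apply: eigs_le_opnorm.
  by apply: hermmx_sum => i _; exact: hB.
- exact: sqrtr_ge0.
Qed.
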